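(* Let $\{a,x\}\subset\mathbb N_0$, $a\le x$, $\{q,\bar q\}\subset[0,\infty)$. If $q>0$ or $\varphi_{\bar q}<1$, and if $q>\mu(\tilde r(\varphi_{\bar q})-1)$ (the latter is equivalent to $\phi_q<\varphi_{\bar q}$ when $\mu>0$), then $$\mathsf P_x\left[e^{-qT_a^--\bar q\int_0^{T_a^-}X_s\,\mathrm ds};T_a^-<\infty\right]=\frac{\Phi_{q,\bar q}(x)}{\Phi_{q,\bar q}(a)},$$ where $$\Phi_{q,\bar q}(z):=(q-\mu(\tilde r(\varphi_{\bar q})-1))\int_0^{\varphi_{\bar q}}\frac{\exp\left\{-\int_{\phi_q}^v\frac{q+\mu(1-\tilde r(w))}{\lambda(\tilde p(w)-w)-\bar qw}\,\mathrm dw\right\}}{\lambda(\tilde p(v)-v)-\bar qv}\,v^z\,\mathrm dv,\qquad z\in\mathbb N_0.$$ Consequently, if $r_{-1}=0$, $\mu>0$ and $\bar q>0$, $$\mathsf P_x\left[e^{-\bar q\int_0^{T_a^-}X_s\,\mathrm ds};T_a^-<\infty\right]=\frac{\int_0^{\varphi_{\bar q}}\frac{\exp\left\{-\int_0^v\frac{\mu(1-\tilde r(w))}{\lambda(\tilde p(w)-w)-\bar qw}\,\mathrm dw\right\}}{\lambda(\tilde p(v)-v)-\bar qv}\,v^x\,\mathrm dv}{\int_0^{\varphi_{\bar q}}\frac{\exp\left\{-\int_0^v\frac{\mu(1-\tilde r(w))}{\lambda(\tilde p(w)-w)-\bar qw}\,\mathrm dw\right\}}{\lambda(\tilde p(v)-v)-\bar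 qv}\,v^a\,\mathrm dv},$$ while if $\mu=0$, then, with no further restriction on $\bar q$, $$\mathsf P_x\left[e^{-\bar q\int_0^{T_a^-}X_s\,\mathrm ds};T_a^-<\infty\right]=\varphi_{\bar q}^{x-a}.$$
   Context: Setting. $\mathbb N=\{1,2,\dots\}$, $\mathbb N_0=\mathbb N\cup\{0\}$. Fix $\lambda\in(0,\infty)$, $\mu\in[0,\infty)$, a probability distribution $p=(p_k)_{k\in\mathbb N_0}$ with $p_0>0$ and $p_1=0$, and a probability distribution $r=(r_k)_{k\in\{-1\}\cup\mathbb N}$ (put $r_0:=0$). Assume that $\mu r_k>0$ for some $k\in\mathbb N$ or $p_0<1$. Under probabilities $(\mathsf P_x)_{x\in\mathbb N_0}$, $X=(X_t)_{t\in[0,\infty)}$ is a minimal càdlàg continuous-time Markov chain with state space $\mathbb N_0$, started from $x$ under $\mathsf P_x$, with explosion time (lifetime) $\zeta$, $X$ being set equal to $\infty$ on $[\zeta,\infty)$, and with conservative generator matrix $(Q_{ij})$: $Q_{00}=0$ (state $0$ is absorbing) and, for $n\in\mathbb N$, $-Q_{nn}=\lambda n+\mu$, $Q_{n(n+m)}=p_{m+1}\lambda n+r_m\mu$ for $m\in\mathbb N\cup\{-1\}$. For $a\in\mathbb N_0$, $T_a^-:=\inf\{t\in[0,\zeta):X_t\le a\}$, $\inf\emptyset:=\infty$. We write $\mathsf P_x[F;A]=\mathsf E_{\mathsf P_x}[F\mathbf 1_A]$. Generating functions and roots. For $z\in(0,1]$, $\tilde p(z):=\sum_{k=0}^\infty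 p_kz^k$ and $\tilde r(z):=\sum_{k=-1}^\infty r_kz^k$. $\varphi$ is the smallest root of $\tilde p(z)=z$ in $z\in(0,1]$. For $\bar q\in(0,\infty)$, $\varphi_{\bar q}$ is the unique root of $\frac{\lambda+\bar q}{\lambda}=\tilde p(z)/z$ in $z\in(0,1)$; $\varphi_0:=\varphi$. If $\mu r_{-1}>0$, then for $q\in(0,\infty)$, $\phi_q$ is the unique root of $q=\mu(\tilde r(z)-1)$ in $z\in(0,1)$, and $\phi$ is the smallest root of $\tilde r(z)=1$ in $z\in(0,1]$; if $\mu r_{-1}=0$, then $\phi_q:=\phi:=0$. Put $\phi_0:=\phi$. *)

(* Defs.v *)
From HB Require Import structures.
From mathcomp Require Import all_boot all_order all_algebra.
From mathcomp Require Import all_classical all_reals all_analysis.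

Set Implicit Arguments.
Unset Strict Implicit.
Unset Printing Implicit Defensive.
Import Order.TTheory GRing.Theory Num.Theory.
Import numFieldNormedType.Exports.

Local Open Scope classical_set_scope.
Local Open Scope ring_scope.

(* Paths are functions f : R -> option nat, of which only the values at times
   t >= 0 matter; None is the cemetery state "infinity" entered at explosion. *)

(* J_0 = 0, J_{n+1} = inf {t >= J_n : f t <> f J_n}; once J_n = +oo the set
   is empty, so that J_{n+1} = +oo as well. *)
Fixpoint jump_time (R : realType) (f : R -> option nat) (n : nat) : \bar R :=
  if n is m.+1 then
    ereal_inf [set t%:E | t in [set t : R |
      (jump_time f m <= t%:E)%E /\ f t <> f (fine (jump_time f m))]]
  else 0%E.

(* Y_n = f J_n; if J_n = +oo this is the last state visited by the path. *)
Fixpoint jump_chain (R : realType) (f : R -> option nat) (n : nat)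
    : option nat :=
  if n is m.+1 then
    if jump_time f m.+1 == +oo%E then jump_chain f m
    else f (fine (jump_time f m.+1))
  else f 0.

(* The time spent in Y_n, for n = 0, 1, ... *)
Definition holding_time (R : realType) (f : R -> option nat) (n : nat)
    : \bar R :=
  if jump_time f n == +oo%E then +oo%E
  else (jump_time f n.+1 - jump_time f n)%E.

Definition explosion_time (R : realType) (f : R -> option nat) : \bar R :=
  ereal_sup (range (jump_time f)).

(* The state space nat is discrete, so that limits are eventual equalities. *)
Definition minimal_cadlag_path (R : realType) (f : R -> option nat) : Prop :=
  [/\ forall t : R, 0 <= t -> \forall s \near t^'+, f s = f t,
      forall t : R, 0 < t -> (t%:E < explosion_time f)%E ->
        exists i : nat, \forall s \near t^'-, f s = Some i
    & forall t : R, 0 <= t ->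
        (f t = None <-> (explosion_time f <= t%:E)%E)].

(* The jump matrix of a conservative generator matrix Q *)
Definition jump_matrix (R : realType) (Q : nat -> nat -> R) (i j : nat) : R :=
  if Q i i == 0 then (i == j)%:R
  else if i == j then 0 else Q i j / - Q i i.

(* Minimal continuous-time Markov chain with conservative generator matrix Q,
   started from x under P x, in the jump chain / holding time form: the jump
   chain is a discrete-time Markov chain with transition matrix jump_matrix Q
   and, given Y_0, ..., Y_n, the first n + 1 holding times are independent and
   exponential with rates - Q Y_k Y_k (rate 0 means an infinite time). *)
Definition minimal_markov_chain (R : realType) (d : measure_display)
    (Omega : measurableType d) (Q : nat -> nat -> R)
    (P : nat -> probability Omega R) (X : R -> Omega -> option nat) : Prop :=
  [/\ forall (t : R) (i : option nat), 0 <= t ->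
        measurable [set w | X t w = i],
      forall w : Omega, minimal_cadlag_path (X ^~ w),
      forall (x n : nat) (i : nat -> nat),
        P x [set w | forall k, (k <= n)%N ->
               jump_chain (X ^~ w) k = Some (i k)] =
        ((i 0%N == x)%:R *
         \prod_(k < n) jump_matrix Q (i k) (i k.+1))%:E
    & forall (x n : nat) (i : nat -> nat) (s : nat -> R),
        (forall k, 0 <= s k) ->
        P x [set w | forall k, (k <= n)%N ->
               jump_chain (X ^~ w) k = Some (i k) /\
               ((s k)%:E < holding_time (X ^~ w) k)%E] =
        (P x [set w | forall k, (k <= n)%N ->
                jump_chain (X ^~ w) k = Some (i k)] *
         (\prod_(k < n.+1) expR (Q (i k) (i k) * s k))%:E)%E].

(* T_a^- *)
Definition first_passage (R : realType) (f : R -> option nat) (a : nat)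
    : \bar R :=
  ereal_inf [set t%:E | t in [set t : R |
    [/\ 0 <= t, (t%:E < explosion_time f)%E
      & exists2 i : nat, f t = Some i & (i <= a)%N]]].

Definition state_value (R : realType) (o : option nat) : \bar R :=
  if o is Some n then (n%:R)%:E else +oo%E.

(* The integral of the path over [0, T] *)
Definition path_area (R : realType) (f : R -> option nat) (T : \bar R)
    : \bar R :=
  (\int[@lebesgue_measure R]_(s in [set s : R | (0 <= s)%R /\ s%:E <= T])
     state_value R (f s))%E.

(* E [exp (- q T_a^- - qbar int_0^{T_a^-} X_s ds) ; T_a^- < oo] under P *)
Definition passage_transform (R : realType) (d : measure_display)
    (Omega : measurableType d) (P : probability Omega R)
    (X : R -> Omega -> option nat) (a : nat) (q qbar : R) : \bar R :=
  (\int[P]_(w in [set w | first_passage (X ^~ w) a < +oo])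
     expeR (- (q%:E * first_passage (X ^~ w) a)
            - qbar%:E * path_area (X ^~ w) (first_passage (X ^~ w) a)))%E.

Definition is_distribution (R : realType) (p : nat -> R) : Prop :=
  (forall k, 0 <= p k) /\ series p @ \oo --> (1 : R).

(* For r : int -> R only the values r k with k >= -1 matter. *)

(* Transitions from n >= 1 go to n + m with m >= -1, i.e. to j with
   n <= j + 1, and then m = j - n. *)
Definition generator (R : realType) (lambda mu : R) (p : nat -> R)
    (r : int -> R) (n j : nat) : R :=
  if n == 0%N then 0
  else if j == n then - (lambda * n%:R + mu)
  else if (n <= j.+1)%N then
    p (j.+1 - n)%N * lambda * n%:R + r (j%:Z - n%:Z) * mu
  else 0.

Definition ptilde (R : realType) (p : nat -> R) (z : R) : R :=
  limn (series (fun k : nat => p k * z ^+ k)).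

Definition rtilde (R : realType) (r : int -> R) (z : R) : R :=
  limn (series (fun k : nat => r (k%:Z - 1) * z ^ (k%:Z - 1))).

Definition varphi (R : realType) (lambda : R) (p : nat -> R) (qbar : R) : R :=
  if qbar == 0 then inf [set z : R | 0 < z <= 1 /\ ptilde p z = z]
  else xget 0 [set z : R | 0 < z < 1 /\
                 (lambda + qbar) / lambda = ptilde p z / z].

Definition phi (R : realType) (mu : R) (r : int -> R) (q : R) : R :=
  if 0 < mu * r (-1) then
    if q == 0 then inf [set z : R | 0 < z <= 1 /\ rtilde r z = 1]
    else xget 0 [set z : R | 0 < z < 1 /\ q = mu * (rtilde r z - 1)]
  else 0.

Definition oriented_integral (R : realType) (f : R -> R) (a b : R) : R :=
  if a <= b then \int[@lebesgue_measure R]_(w in `[a, b]) f w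
  else - \int[@lebesgue_measure R]_(w in `[b, a]) f w.

Definition denominator (R : realType) (lambda : R) (p : nat -> R) (qbar v : R)
    : R :=
  lambda * (ptilde p v - v) - qbar * v.

(* int_0^{varphi_qbar}
     exp (- int_c^v num(w) / denominator(w) dw) / denominator(v) v^z dv *)
Definition weighted_moment (R : realType) (lambda : R) (p : nat -> R)
    (qbar : R) (num : R -> R) (c : R) (z : nat) : R :=
  \int[@lebesgue_measure R]_(v in `]0, varphi lambda p qbar[)
    (expR (- oriented_integral
               (fun w => num w / denominator lambda p qbar w) c v)
     / denominator lambda p qbar v * v ^+ z).

Definition Phi (R : realType) (lambda mu : R) (p : nat -> R) (r : int -> R)
    (q qbar : R) (z : nat) : R :=
  (q - mu * (rtilde r (varphi lambda p qbar) - 1)) *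
  weighted_moment lambda p qbar (fun w => q + mu * (1 - rtilde r w))
    (phi mu r q) z.

(* Main.v *)
Require Import Defs.
From HB Require Import structures.
From mathcomp Require Import all_boot all_order all_algebra.
From mathcomp Require Import all_classical all_reals all_analysis.
From mathcomp Require Import measurable_realfun.
From mathcomp Require Import ring lra zify.

Set Implicit Arguments.
Unset Strict Implicit.
Unset Printing Implicit Defensive.
Import Order.TTheory GRing.Theory Num.Theory.
Import numFieldNormedType.Exports.

Local Open Scope classical_set_scope.
Local Open Scope ring_scope.

(** The transform is the value, for a discrete chain with discounted jumps, of
    being absorbed in {0, ..., a}; this value is characterized by a linear
    recursion, which the integrals in the statement solve.

    Probability. Given the jump chain, the holding time in i is exponential of
    rate lambda i + mu, and up to the passage time both q T and qbar times the
    area are sums over the holding times, so that a visit to i contributes the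
    Laplace transform of the holding time at q + qbar i (laplace_from_tail). The
    transform is therefore the sum over n of the weights of the paths that enter
    {0, ..., a} at their n-th step, for the kernel of jump probabilities
    discounted by these factors (passage_transformE). The events of the jump chain
    and of the holding times are measurable because paths are right-continuous.

    Uniqueness. A nonnegative h with h a = 1 that is harmonic for the kernel above
    a and vanishes at infinity equals that sum (passage_value_harmonic). The sum
    is at most h, by induction on the number of steps. The difference vanishes at
    a and at infinity, so a nonzero one would have a smallest maximizer; since the
    chain can step down by one, and only by one, the maximum principle excludes
    this.

    Harmonic functions. Write D(v) = lambda (ptilde v - v) - qbar v,
    N(v) = q + mu (1 - rtilde v), and let E be the exponential of minus the
    integral of N / D from phi. The generator minus the discount q + qbar n maps
    j |-> v^j, at n, to n v^(n-1) D(v) - v^n N(v). Multiplied by the weight E / D,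
    this is the derivative of v^n E, since E' = - E N / D. For n > 0 the boundary
    terms at 0 and at varphi vanish (weight_balance), so the moments of the weight
    are harmonic (weighted_moment_harmonic); they tend to 0 because varphi <= 1.
    The lower limit phi is where N changes sign: this makes E <= 1. The hypothesis
    N(varphi) > 0 makes E vanish at varphi, where D does, and the weight
    integrable there.

    Roots. That N and D have the required signs follows from one monotonicity: for
    a generating function ptilde with ptilde 0 > 0, the slope
    (ptilde z / z - 1) / (1 - z) is strictly decreasing on (0, 1)
    (chord_slope_decr).

    If mu = 0 and q = 0, powers of varphi are harmonic. When varphi = 1 they do not
    vanish at infinity; the value is then 1 as the supremum over z < 1 of the
    values z^(x - a) that belong to larger discounts (passage_value_power). *)

(** * Generating functions of distributions *)

Section PowerSeries.
Variable R : realType.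
Implicit Types s : nat -> R.

Lemma pgf_term_le s z : is_distribution s -> 0 <= z <= 1 ->
  forall k, 0 <= s k * z ^+ k <= s k.
Proof.
move=> [s0 _] /andP[z0 z1] k.
by rewrite mulr_ge0 ?exprn_ge0//= ler_piMr// exprn_ile1.
Qed.

Lemma ptilde_cvg s z : is_distribution s -> 0 <= z <= 1 ->
  series (fun k => s k * z ^+ k) @ \oo --> ptilde s z.
Proof.
move=> hs hz; have [s0 s1] := hs.
apply: (@series_le_cvg _ _ s) => //.
- by move=> n; have /andP[] := pgf_term_le hs hz n.
- by move=> n; have /andP[] := pgf_term_le hs hz n.
- by apply/cvg_ex; exists 1.
Qed.

Lemma ptilde1 s : is_distribution s -> ptilde s 1 = 1.
Proof.
move=> [s0 s1]; rewrite /ptilde.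
under [X in series X]eq_fun do rewrite expr1n mulr1.
exact: cvg_lim.
Qed.

Lemma ptilde_at0 s : is_distribution s -> ptilde s 0 = s 0%N.
Proof.
move=> hs; apply: (@cvg_lim R) => //.
rewrite -(cvg_shiftS _) /=.
rewrite (_ : (fun n => _) = cst (s 0%N)); first exact: cvg_cst.
apply/funext => n; rewrite seriesEnat/= big_nat_recl//= expr0 mulr1.
by rewrite big1 ?addr0// => i _; rewrite expr0n mulr0.
Qed.

Lemma ptilde_eseries s z : is_distribution s -> 0 <= z <= 1 ->
  (\sum_(0 <= k <oo) (s k * z ^+ k)%:E)%E = (ptilde s z)%:E.
Proof.
move=> hs hz; apply: cvg_lim => //.
under eq_fun do rewrite sumEFin.
apply: cvg_EFin; first by apply: nearW.
have := ptilde_cvg hs hz; rewrite seriesEnat; exact.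
Qed.

Lemma ptilde_lb s z : is_distribution s -> 0 <= z <= 1 -> s 0%N <= ptilde s z.
Proof.
move=> hs hz; rewrite -lee_fin -ptilde_eseries// (@nneseriesD1 _ _ 0%N)//=.
  rewrite expr0 mulr1 leeDl// nneseries_ge0// => k _ _.
  by rewrite lee_fin; have /andP[] := pgf_term_le hs hz k.
by move=> k _; rewrite lee_fin; have /andP[] := pgf_term_le hs hz k.
Qed.

Lemma ptilde_ge0 s z : is_distribution s -> 0 <= z <= 1 -> 0 <= ptilde s z.
Proof.
by move=> hs hz; apply: le_trans (ptilde_lb hs hz); case: hs.
Qed.

Lemma ptilde_mono s y z : is_distribution s -> 0 <= y -> y <= z -> z <= 1 ->
  ptilde s y <= ptilde s z.
Proof.
move=> hs y0 yz z1.
have [s0 _] := hs; have hy : 0 <= y <= 1 by rewrite y0 (le_trans yz).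
have hz : 0 <= z <= 1 by rewrite z1 (le_trans y0).
apply: ler_cvg_to (ptilde_cvg hs hy) (ptilde_cvg hs hz) _.
apply: nearW => n; rewrite !seriesEnat; apply: ler_sum => k _.
by rewrite ler_wpM2l ?lerXn2r// ?nnegrE ?(le_trans y0).
Qed.

Lemma ptilde_le1 s z : is_distribution s -> 0 <= z <= 1 -> ptilde s z <= 1.
Proof.
by move=> hs /andP[z0 z1]; rewrite -(ptilde1 hs); exact: ptilde_mono.
Qed.

(** The graph of a generating function on [0, 1] lies below its chord, because
    z^k <= z for k > 0. *)
Lemma ptilde_le_chord s z : is_distribution s -> 0 <= z <= 1 ->
  ptilde s z <= s 0%N + (1 - s 0%N) * z.
Proof.
move=> hs hz; have [s0 s1] := hs; have /andP[z0 z1] := hz.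
have c : series s n * z + s 0%N * (1 - z) @[n --> \oo] --> 1 * z + s 0%N * (1 - z).
  by apply: cvgD; [apply: cvgMr_tmp|exact: cvg_cst].
rewrite (_ : _ + _ = 1 * z + s 0%N * (1 - z)); last by ring.
apply: ler_cvg_to (ptilde_cvg hs hz) c _.
near=> n; have n0 : (0 < n)%N by near: n; exists 1%N.
rewrite -(prednK n0) !seriesEnat/= !big_nat_recl//= expr0 mulr1.
rewrite mulrDl addrAC -mulrDr addrCA subrr addr0 mulr1 lerD2l mulr_suml.
apply: ler_sum => k _; rewrite ler_wpM2l// exprS ler_piMr//.
exact: exprn_ile1.
Unshelve. all: by end_near. Qed.

(** The bound on the remainder does not depend on z: the partial sums converge
    uniformly on [0, 1]. *)
Lemma ptilde_tail s z n : is_distribution s -> 0 <= z <= 1 ->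
  0 <= ptilde s z - series (fun k => s k * z ^+ k) n <= 1 - series s n.
Proof.
move=> hs hz; have [s0 s1] := hs.
have c1 : series (fun k => s k * z ^+ k) m - series (fun k => s k * z ^+ k) n
    @[m --> \oo] --> ptilde s z - series (fun k => s k * z ^+ k) n.
  by apply: cvgB; [exact: ptilde_cvg|exact: cvg_cst].
have c2 : series s m - series s n @[m --> \oo] --> 1 - series s n.
  by apply: cvgB => //; exact: cvg_cst.
apply/andP; split.
- apply: (@cvgr_to_ge _ _ _ _ _ _ _ c1); near=> m.
  have nm : (n <= m)%N by near: m; exists n.
  rewrite sub_series_geq//; apply: sumr_ge0 => k _.
  by have /andP[] := pgf_term_le hs hz k.
- apply: ler_cvg_to c1 c2 _; near=> m.
  have nm : (n <= m)%N by near: m; exists n.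
  rewrite !sub_series_geq//; apply: ler_sum => k _.
  by have /andP[] := pgf_term_le hs hz k.
Unshelve. all: by end_near. Qed.

Lemma ptilde_continuous s : is_distribution s ->
  {within `[0, 1], continuous (ptilde s)}.
Proof.
move=> hs; have [s0 s1] := hs.
pose P n (z : R) := series (fun k => s k * z ^+ k) n.
have cP n : continuous (P n).
  rewrite /P /series/=; elim: n => [|n IH] z.
    by under eq_fun do rewrite big_geq//; exact: cvg_cst.
  under eq_fun do rewrite big_nat_recr//=.
  apply: cvgD; first exact: IH.
  by apply: cvgMl_tmp; exact: exprn_continuous.
apply: (@uniform_limit_continuous_subspace _ _ _ (P @ \oo)).
  by near_simpl; apply: nearW => n; exact: (continuous_subspaceT (cP n)).
move=> U /uniform_nbhs [E [entE EU]].
move: entE; rewrite -entourage_ballE => -[e /= e0 eE].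
have : \forall n \near \oo, 1 - series s n < e.
  move/cvgrPdist_lt : s1 => /(_ _ e0); apply: filterS => n.
  exact/le_lt_trans/ler_norm.
apply: filterS => n ne; apply: EU => z /= zI; apply: eE => /=.
rewrite /ball /= /P.
have z01 : 0 <= z <= 1 by move: zI; rewrite in_itv.
have /andP[t0 t1] := ptilde_tail n hs z01.
by rewrite ger0_norm// (le_lt_trans t1).
Unshelve. all: by end_near. Qed.
End PowerSeries.

(** * Roots of ptilde s z / z = 1 + c *)

Section Roots.
Variable R : realType.
Implicit Types s : nat -> R.

(** For k > 0 the quotient (z^k - z) / (z (1 - z)) is - (1 + z + ... + z^(k-2)),
    which decreases in z; for k = 0 it is 1/z, whose decrease is kept as a gain. *)
Lemma chord_slope_term k (y z : R) : 0 < y -> y < z -> z < 1 ->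
  (z ^+ k - z) / (z * (1 - z)) + (k == 0)%:R * (y^-1 - z^-1)
    <= (y ^+ k - y) / (y * (1 - y)).
Proof.
move=> y0 yz z1; have z0 : 0 < z by rewrite (lt_trans y0).
have y1 : y < 1 by rewrite (lt_trans yz).
case: k => [|k] /=.
  rewrite mul1r !expr0.
  have -> : (1 - z) / (z * (1 - z)) = z^-1 by field; lra.
  have -> : (1 - y) / (y * (1 - y)) = y^-1 by field; lra.
  lra.
rewrite mul0r addr0.
have E (t : R) : 0 < t -> t < 1 ->
    (t ^+ k.+1 - t) / (t * (1 - t)) = - \sum_(i < k) t ^+ i.
  move=> t0 t1; have -> : t ^+ k.+1 - t = t * (t ^+ k - 1) by rewrite exprS; ring.
  rewrite subrX1; field; lra.
rewrite !E// lerN2; apply: ler_sum => i _.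
by rewrite lerXn2r ?nnegrE ?ltW.
Qed.

(** Summing the termwise bounds with the weights s k, which add up to 1; the gain
    at k = 0 makes the monotonicity strict as soon as s 0 > 0. *)
Lemma chord_slope_decr s y z : is_distribution s -> 0 < s 0%N ->
  0 < y -> y < z -> z < 1 ->
  (ptilde s z / z - 1) / (1 - z) < (ptilde s y / y - 1) / (1 - y).
Proof.
move=> hs s00 y0 yz z1; have [s0 s1] := hs.
have z0 : 0 < z by rewrite (lt_trans y0).
have y1 : y < 1 by rewrite (lt_trans yz).
have c (t : R) : 0 < t -> t < 1 ->
    series (fun k => s k * ((t ^+ k - t) / (t * (1 - t)))) @ \oo
      --> (ptilde s t / t - 1) / (1 - t).
  move=> t0 t1.
  have -> : (ptilde s t / t - 1) / (1 - t) =
      ptilde s t * (t * (1 - t))^-1 - 1 * (1 - t)^-1 by field; lra.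
  have -> : series (fun k => s k * ((t ^+ k - t) / (t * (1 - t)))) =
      (fun n => series (fun k => s k * t ^+ k) n * (t * (1 - t))^-1
                - series s n * (1 - t)^-1).
    apply/funext => n; rewrite !seriesEnat/= !mulr_suml -sumrB.
    by apply: eq_bigr => k _; field; lra.
  apply: cvgB; apply: cvgMr_tmp => //.
  by apply: ptilde_cvg => //; lra.
rewrite -subr_gt0; apply: (@lt_le_trans _ _ (s 0%N * (y^-1 - z^-1))).
  by rewrite mulr_gt0// subr_gt0 ltf_pV2.
rewrite lerBrDr.
have c1 : s 0%N * (y^-1 - z^-1) + series (fun k => s k * ((z ^+ k - z) / (z * (1 - z)))) n
   @[n --> \oo] --> s 0%N * (y^-1 - z^-1) + (ptilde s z / z - 1) / (1 - z).
  by apply: cvgD; [exact: cvg_cst|exact: c].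
apply: ler_cvg_to c1 (c _ y0 y1) _; near=> n.
have n0 : (0 < n)%N by near: n; exists 1%N.
rewrite -(prednK n0) !seriesEnat /= !big_nat_recl//= addrA.
apply: lerD.
  rewrite -mulrDr ler_wpM2l// addrC.
  by have := chord_slope_term 0 y0 yz z1; rewrite mul1r.
apply: ler_sum => k _; rewrite ler_wpM2l//.
by have := chord_slope_term k.+1 y0 yz z1; rewrite mul0r addr0.
Unshelve. all: by end_near. Qed.

(** Strict monotonicity of the slope (ptilde s z / z - 1) / (1 - z) gives the
    sign of ptilde s z / z - 1 - c on both sides of any root. *)
Lemma root_signs s c b : is_distribution s -> 0 < s 0%N -> 0 <= c ->
  0 < b <= 1 -> ptilde s b / b = 1 + c ->
  (b = 1 -> forall z, 0 < z < 1 -> 1 + c < ptilde s z / z) ->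
  (forall z, 0 < z < b -> 1 + c < ptilde s z / z) /\
  (forall z, b < z < 1 -> ptilde s z / z < 1 + c).
Proof.
move=> hs s00 c0 /andP[b0]; rewrite le_eqVlt => /orP[/eqP -> _ /(_ erefl) H|].
  by split=> // z /andP[z1 /(lt_trans z1)]; rewrite ltxx.
move=> b1 bE _; split=> z /andP[h1 h2].
  have := chord_slope_decr hs s00 h1 h2 b1.
  rewrite bE addrAC subrr add0r ltr_pdivlMr; last by lra.
  move=> /(le_lt_trans _) H; rewrite addrC -ltrBrDr; apply: H.
  by rewrite -mulrA ler_peMr// mulrC ler_pdivlMr; lra.
have b2 : 0 < z by lra.
have := chord_slope_decr hs s00 b0 h1 h2.
rewrite bE addrAC subrr add0r ltr_pdivrMr; last by lra.
move=> /lt_le_trans H; rewrite addrC -ltrBlDr; apply: H.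
by rewrite -mulrA ler_piMr// mulrC ler_pdivrMr; lra.
Qed.

(** The function ptilde s z - (1 + c) z is s 0 > 0 at 0 and - c <= 0 at 1. When
    c = 0 the point 1 is a root, possibly the only one. *)
Lemma root_exists s c : is_distribution s -> 0 < s 0%N -> 0 <= c ->
  exists b, [/\ 0 < b <= 1, ptilde s b / b = 1 + c, 0 < c -> b < 1
    & b = 1 -> forall z, 0 < z < 1 -> 1 + c < ptilde s z / z].
Proof.
move=> hs s00 c0.
have ivt t : 0 < t <= 1 -> ptilde s t <= (1 + c) * t ->
    exists b, [/\ 0 < b, b <= t & ptilde s b / b = 1 + c].
  move=> /andP[t0 t1] pt.
  pose f z := ptilde s z - (1 + c) * z.
  have cf : {within `[0, t], continuous f}.
    move=> z; apply: cvgB.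
      apply: (continuous_subspaceW _ (ptilde_continuous hs)).
      by apply: subset_itvl; rewrite bnd_simp.
    apply: continuous_subspaceT => {}z; apply: cvgMl_tmp; exact: cvg_id.
  have f0 : 0 < f 0 by rewrite /f ptilde_at0// mulr0 subr0.
  have ft : f t <= 0 by rewrite subr_le0.
  have [] := @IVT _ f 0 t 0 (ltW t0) cf.
    by rewrite minElt maxElt ltNge (le_trans ft (ltW f0))/= ft ltW.
  move=> b; rewrite in_itv /= => /andP[b0 bt] /eqP; rewrite subr_eq0 => /eqP fb.
  have {}b0 : 0 < b.
    rewrite lt_neqAle b0 andbT; apply/eqP => bE; move: fb s00.
    by rewrite -bE mulr0 ptilde_at0// => ->; rewrite ltxx.
  by exists b; split=> //; rewrite fb; field; lra.
have [c1|c1] := ltP 0 c.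
  have [||b [b0 b1 bE]] := ivt 1; rewrite ?ptilde1//; [lra|lra|].
  have b1' : b < 1.
    rewrite lt_neqAle b1 andbT; apply/eqP => E; move: bE.
    by rewrite E ptilde1//; lra.
  by exists b; split=> //; [rewrite b0 b1|lra].
have c00 : c = 0 by lra.
rewrite c00 in ivt *.
have [H|] := pselect (forall z, 0 < z < 1 -> 1 < ptilde s z / z).
  exists 1; rewrite ptilde1// addr0; split=> //; lra.
move/existsNP => [z /not_implyP[/andP[z0 z1] /negP]]; rewrite -leNgt => zl.
have [||b [b0 bz bE]] := ivt z; first by lra.
  by rewrite addr0 mul1r; move: zl; rewrite ler_pdivrMr// mul1r.
by exists b; rewrite addr0; move: bE; rewrite addr0 => bE; split => //; lra.
Qed.

End Roots.

(** * The roots varphi and phi *)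

Section RootSpecs.
Variable R : realType.
Implicit Types s p : nat -> R.

(** Both varphi and phi are defined as an infimum for c = 0 and by choice for
    c > 0; below 1 the root is unique, so that the choice is forced. *)
Lemma smallest_root s c b (A B : set R) : is_distribution s -> 0 < s 0%N ->
  0 <= c -> 0 < b <= 1 -> ptilde s b / b = 1 + c -> (0 < c -> b < 1) ->
  (b = 1 -> forall z, 0 < z < 1 -> 1 + c < ptilde s z / z) ->
  (c = 0 -> forall z, A z <-> 0 < z <= 1 /\ ptilde s z / z = 1) ->
  (forall z, B z <-> 0 < z < 1 /\ ptilde s z / z = 1 + c) ->
  (if c == 0 then inf A else xget 0 B) = b.
Proof.
move=> hs s00 c0 hb bE cb b1 hA hB.
have [lo hi] := root_signs hs s00 c0 hb bE b1.
case: eqP => [c00|/eqP cN0].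
  have Ab : A b by apply/hA => //; rewrite bE c00 addr0.
  have lbA : lbound A b.
    move=> z /hA[]// z0 zE; rewrite leNgt; apply/negP => zb.
    have := lo z; rewrite zE c00 zb; lra.
  apply/eqP; rewrite eq_le; apply/andP; split.
    by apply: ge_inf => //; exists b.
  by apply: lb_le_inf => //; exists b.
have {}cb : b < 1 by rewrite cb// lt_neqAle eq_sym cN0.
case: xgetP => [z zE /hB[z0 zS]|/(_ b)]; last first.
  by case; apply/hB; split=> //; lra.
by have [zb|zb|->//] := ltgtP z b;
  [have := lo z; rewrite zS zb|have := hi z; rewrite zS zb]; lra.
Qed.

Lemma varphi_spec (lambda qbar : R) p (b := varphi lambda p qbar) :
  is_distribution p -> 0 < p 0%N -> 0 < lambda -> 0 <= qbar ->
  [/\ 0 < b <= 1, ptilde p b / b = 1 + qbar / lambda, 0 < qbar -> b < 1,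
      forall z, 0 < z < b -> 1 + qbar / lambda < ptilde p z / z
    & forall z, b < z < 1 -> ptilde p z / z < 1 + qbar / lambda].
Proof.
move=> hp p0 l0 q0.
have c0 : 0 <= qbar / lambda by rewrite divr_ge0// ltW.
have [b' [h1 h2 h3 h4]] := root_exists hp p0 c0.
have -> : b = b'.
  rewrite -(@smallest_root p (qbar / lambda) b'
    [set z : R | 0 < z <= 1 /\ ptilde p z = z]
    [set z : R | 0 < z < 1 /\ (lambda + qbar) / lambda = ptilde p z / z])//.
  - by rewrite mulf_eq0 invr_eq0 (gt_eqF l0) orbF.
  - move=> _ z; split=> -[z0 zE]; split=> //.
      by rewrite zE divff//; lra.
    by rewrite -[LHS](@divfK _ z) ?zE ?mul1r//; lra.
  - move=> z /=; have -> : (lambda + qbar) / lambda = 1 + qbar / lambda.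
      by field; lra.
    by split=> -[].
have [lo hi] := root_signs hp p0 c0 h1 h2 h4.
split => // qb; apply: h3.
by rewrite divr_gt0.
Qed.

Lemma rtilde_ptilde (r : int -> R) z : is_distribution (fun k => r (k%:Z - 1)) ->
  0 < z <= 1 -> rtilde r z = ptilde (fun k => r (k%:Z - 1)) z / z.
Proof.
move=> hr /andP[z0 z1]; apply: (@cvg_lim R) => //.
rewrite [X in X @ _ --> _](_ : _ =
  fun n => series (fun k : nat => r (k%:Z - 1) * z ^+ k) n * z^-1); last first.
  apply/funext => n; rewrite !seriesEnat/= mulr_suml; apply: eq_bigr => k _.
  rewrite -mulrA; congr (_ * _).
  by rewrite expfzDr ?gt_eqF// exprnP exprN1.
by apply: cvgMr_tmp; apply: ptilde_cvg => //; lra.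
Qed.

Lemma rtilde1 (r : int -> R) : is_distribution (fun k => r (k%:Z - 1)) ->
  rtilde r 1 = 1.
Proof. by move=> hr; rewrite rtilde_ptilde ?ptilde1 ?divr1 ?ltr01 ?lexx. Qed.

Lemma phi_spec (mu q : R) (r : int -> R) (c := phi mu r q) :
  is_distribution (fun k => r (k%:Z - 1)) -> 0 < mu -> 0 < r (-1) -> 0 <= q ->
  [/\ 0 < c <= 1, rtilde r c = 1 + q / mu, 0 < q -> c < 1,
      forall z, 0 < z < c -> 1 + q / mu < rtilde r z
    & forall z, c < z < 1 -> rtilde r z < 1 + q / mu].
Proof.
move=> hr mu0 r0 q0.
have c0 : 0 <= q / mu by rewrite divr_ge0// ltW.
have [b' [h1 h2 h3 h4]] := root_exists hr r0 c0.
have -> : c = b'.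
  rewrite /c /phi mulr_gt0//.
  rewrite -(@smallest_root _ (q / mu) b'
    [set z : R | 0 < z <= 1 /\ rtilde r z = 1]
    [set z : R | 0 < z < 1 /\ q = mu * (rtilde r z - 1)] hr)//.
  - by rewrite mulf_eq0 invr_eq0 (gt_eqF mu0) orbF.
  - by move=> _ z; split=> -[z0 zE]; split=> //; move: zE; rewrite rtilde_ptilde.
  - move=> z /=; split=> -[z0 zE]; split=> //; move: zE; rewrite rtilde_ptilde//;
      try lra.
      by move=> ->; field; lra.
    by move=> ->; field; lra.
have [lo hi] := root_signs hr r0 c0 h1 h2 h4.
rewrite rtilde_ptilde//; split => //.
- by move=> qb; apply: h3; rewrite divr_gt0.
- by move=> z zb; rewrite rtilde_ptilde ?lo//; lra.
- by move=> z zb; rewrite rtilde_ptilde ?hi//; lra.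
Qed.

Lemma up_distribution (r : int -> R) : is_distribution (fun k => r (k%:Z - 1)) ->
  r (-1) = 0 -> is_distribution (fun k => r k%:Z).
Proof.
move=> [h0 h1] r1; split; first by move=> k; have := h0 k.+1; rewrite -addn1 PoszD addrK.
move: h1; rewrite -(cvg_shiftS _) /=.
suff -> : (fun n => series (fun k : nat => r (k%:Z - 1)) n.+1) =
  series (fun k => r k%:Z) by [].
apply/funext => n; rewrite !seriesEnat/= big_nat_recl//= sub0r r1 add0r.
by apply: eq_bigr => k _; rewrite -addn1 PoszD addrK.
Qed.

Lemma rtilde_up (r : int -> R) z : is_distribution (fun k => r (k%:Z - 1)) ->
  r (-1) = 0 -> 0 <= z <= 1 -> rtilde r z = ptilde (fun k => r k%:Z) z.
Proof.
move=> hr r1 z01; have hr' := up_distribution hr r1.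
apply: (@cvg_lim R) => //.
rewrite -(cvg_shiftS _) /=.
rewrite [X in X @ _ --> _](_ : _ = series (fun k => r k%:Z * z ^+ k)).
  exact: ptilde_cvg.
apply/funext => n; rewrite !seriesEnat/= big_nat_recl//= sub0r r1 mul0r add0r.
by apply: eq_bigr => k _; rewrite -addn1 PoszD addrK.
Qed.

Lemma rtilde_up_le (r : int -> R) z : is_distribution (fun k => r (k%:Z - 1)) ->
  r (-1) = 0 -> r 0 = 0 -> 0 <= z <= 1 -> rtilde r z <= z.
Proof.
move=> hr r1 r0 z01; rewrite rtilde_up//.
apply: le_trans (ptilde_le_chord (up_distribution hr r1) z01) _.
by rewrite r0 subr0 mul1r add0r.
Qed.

(** Comparing phi with a point of (0, 1] is reading off a sign of
    q - mu (rtilde - 1). *)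
Lemma lt_phi (mu q b : R) (r : int -> R) :
  is_distribution (fun k => r (k%:Z - 1)) -> r 0 = 0 ->
  0 < mu -> 0 <= q -> 0 < b <= 1 -> 0 < q \/ b < 1 ->
  mu * (rtilde r b - 1) < q <-> phi mu r q < b.
Proof.
move=> hr r0 mu0 q0 hb qb.
have [r1|r1] := ltP 0 (r (-1)).
  have [h1 h2 h3 h4 h5] := phi_spec hr mu0 r1 q0.
  have E : (mu * (rtilde r b - 1) < q) = (rtilde r b < 1 + q / mu).
    by rewrite -[RHS]ltrBlDl ltr_pdivlMr// mulrC.
  rewrite E; have [bc|cb|cb] := ltgtP (phi mu r q) b.
  - split => // _; have [b1|b1] := ltP b 1; first by apply: h5; rewrite bc.
    have -> : b = 1 by lra.
    rewrite rtilde1//; have : 0 < q / mu by rewrite divr_gt0//; lra.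
    lra.
  - split=> //; have := h4 b; lra.
  - by rewrite -h2 cb; split; lra.
have {}r1 : r (-1) = 0.
  by have [h _] := hr; have := h 0%N; rewrite sub0r; lra.
rewrite /phi r1 mulr0 ltxx; split => [_|_]; first lra.
have b01 : 0 <= b <= 1 by lra.
have := rtilde_up_le hr r1 r0 b01.
have [?|?] := ltP b 1.
  by move=> rb; apply: lt_le_trans q0; rewrite nmulr_llt0 ?mu0 //; lra.
have -> : b = 1 by lra.
by rewrite rtilde1// subrr mulr0; lra.
Qed.

End RootSpecs.

(** * Jumps and first passage of a path *)

Section Paths.
Variable R : realType.
Implicit Types f : R -> option nat.
Arguments jump_time : simpl never.
Arguments jump_chain : simpl never.

Definition chain_state f n : nat := odflt 0%N (jump_chain f n).
Definition hold f n : R := fine (holding_time f n).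

Definition hits_at f a N :=
  (forall k, (k < N)%N -> (a < chain_state f k)%N) /\
  (chain_state f N <= a)%N.

Lemma jump_time_le f n : (jump_time f n <= jump_time f n.+1)%E.
Proof. by apply: le_ereal_inf_tmp => _ [t [tn _]] <-. Qed.

Lemma jump_time_mono f m n : (m <= n)%N -> (jump_time f m <= jump_time f n)%E.
Proof.
move=> /subnKC <-; elim: (n - m)%N => [|k IH]; first by rewrite addn0.
by rewrite addnS (le_trans IH)// jump_time_le.
Qed.

Lemma jump_time_ge0 f n : (0 <= jump_time f n)%E.
Proof. exact: (@jump_time_mono f 0%N). Qed.

Lemma jump_time_fin f n : (jump_time f n < +oo)%E ->
  jump_time f n = (fine (jump_time f n))%:E.
Proof. by move=> h; rewrite fineK// ge0_fin_numE// jump_time_ge0. Qed.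

Lemma fine_jump_time_ge0 f n : 0 <= fine (jump_time f n).
Proof. exact/fine_ge0/jump_time_ge0. Qed.

Lemma constant_before_jump f n s :
  (jump_time f n <= s%:E)%E -> (s%:E < jump_time f n.+1)%E ->
  f s = f (fine (jump_time f n)).
Proof.
move=> ns sn; apply: contrapT => fs; move: sn; rewrite ltNge => /negP; apply.
by apply: ereal_inf_lbound; exists s.
Qed.

Lemma rc_interval f t : minimal_cadlag_path f -> 0 <= t ->
  exists2 e, 0 < e & forall s, t <= s -> s < t + e -> f s = f t.
Proof.
move=> [rc _ _] t0; have [e /= e0 he] := rc t t0.
exists e => // s; rewrite le_eqVlt => /orP[/eqP -> //|ts] se.
by apply: he => //=; rewrite distrC ger0_norm ?subr_ge0 ?ltW//; lra.
Qed.

Lemma jump_time_lt f n : minimal_cadlag_path f -> (jump_time f n < +oo)%E ->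
  (jump_time f n < jump_time f n.+1)%E.
Proof.
move=> hf /jump_time_fin nE.
have [e e0 he] := rc_interval hf (fine_jump_time_ge0 f n).
apply: (@lt_le_trans _ _ (fine (jump_time f n) + e)%:E).
  by rewrite {1}nE lte_fin ltrDl.
apply: le_ereal_inf_tmp => _ [s [ns fs] <-].
rewrite lee_fin leNgt; apply/negP => se; apply: fs; apply: he => //.
by rewrite -lee_fin -nE.
Qed.

(** By right-continuity a jump time is followed by a strictly later one, so it
    is not an explosion time and the state entered there is finite. *)
Lemma jump_before_explosion f n : minimal_cadlag_path f ->
  (jump_time f n < +oo)%E -> (jump_time f n < explosion_time f)%E.
Proof.
move=> hf /(jump_time_lt hf)/lt_le_trans; apply.
by apply: ereal_sup_ubound; exists n.+1.
Qed.

Lemma jump_interval f t : minimal_cadlag_path f -> 0 <= t ->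
  (t%:E < explosion_time f)%E ->
  exists n, (jump_time f n <= t%:E < jump_time f n.+1)%E.
Proof.
move=> hf t0 /ereal_sup_gt[_ [m _ <-] tm].
have [[|n] tn nmin] := ex_minnP (ex_intro (fun m => t%:E < jump_time f m)%E m tm).
  by move: tn; rewrite /= lte_fin ltNge t0.
exists n; rewrite tn andbT leNgt; apply/negP => /nmin.
by rewrite ltnn.
Qed.

Lemma jump_chainS f n : jump_chain f n.+1 =
  if jump_time f n.+1 == +oo%E then jump_chain f n
  else f (fine (jump_time f n.+1)).
Proof. by []. Qed.

Lemma jump_chainE f n : (jump_time f n < +oo)%E ->
  jump_chain f n = f (fine (jump_time f n)).
Proof. by case: n => [//|n]; rewrite lt_neqAle jump_chainS => /andP[/negPf ->]. Qed.

Lemma jump_chain_Some f n : minimal_cadlag_path f ->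
  jump_chain f n = Some (chain_state f n).
Proof.
move=> hf.
have fin m : (jump_time f m < +oo)%E -> f (fine (jump_time f m)) <> None.
  move=> mE /(proj1 (let: And3 _ _ h := hf in h _ (fine_jump_time_ge0 f m))).
  by rewrite -jump_time_fin// leNgt jump_before_explosion.
suff : jump_chain f n <> None by rewrite /chain_state; case: (jump_chain f n).
elim: n => [|n IH]; first by apply: (fin 0%N); rewrite ltry.
rewrite jump_chainS; case: eqP => // /eqP h.
by apply: (fin n.+1); rewrite lt_neqAle h leey.
Qed.

(** After its last jump the chain keeps its state, hence entering {0, ..., a}
    from above takes a jump at a finite time. *)
Lemma hits_at_finite f a N : minimal_cadlag_path f -> hits_at f a N ->
  (jump_time f N < +oo)%E.
Proof.
move=> hf [lo hi]; case: N lo hi => [_ _|N lo hi]; first exact: ltry.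
rewrite lt_neqAle leey andbT; apply/negP => /eqP NE.
have := lo N (leqnn _); rewrite ltnNge => /negP; apply.
by move: hi; rewrite /chain_state jump_chainS NE eqxx.
Qed.

Lemma jump_time_sum f n : minimal_cadlag_path f -> (jump_time f n < +oo)%E ->
  jump_time f n = (\sum_(k < n) hold f k)%:E.
Proof.
move=> hf; elim: n => [|n IH] n1; first by rewrite big_ord0.
have n0 := le_lt_trans (jump_time_le f n) n1.
rewrite big_ord_recr /= EFinD -IH// /hold /holding_time lt_eqF//.
move: (jump_time_fin n0) (jump_time_fin n1).
move: (fine (jump_time f n)) (fine (jump_time f n.+1)) => t u -> ->.
by rewrite -EFinD /= subrKC.
Qed.

Lemma hits_at_passage f a N : minimal_cadlag_path f -> hits_at f a N ->
  first_passage f a = (\sum_(k < N) hold f k)%:E.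
Proof.
move=> hf hN; have Nfin := hits_at_finite hf hN; have [lo hi] := hN.
rewrite -jump_time_sum//; apply/eqP; rewrite eq_le; apply/andP; split.
  apply: ereal_inf_lbound; exists (fine (jump_time f N)).
    split; [exact: fine_jump_time_ge0| |].
      by rewrite -jump_time_fin// jump_before_explosion.
    by exists (chain_state f N) => //; rewrite -jump_chainE// jump_chain_Some.
  by rewrite -jump_time_fin.
apply: le_ereal_inf_tmp => _ [t [t0 tz [i fi ia]] <-].
rewrite leNgt; apply/negP => tN.
have [n /andP[nt tn]] := jump_interval hf t0 tz.
have nN : (n < N)%N.
  rewrite ltnNge; apply/negP => /(jump_time_mono f) Nn.
  by have := lt_le_trans tN (le_trans Nn nt); rewrite ltxx.
have nfin : (jump_time f n < +oo)%E by rewrite (le_lt_trans nt)// ltry.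
have := lo n nN; rewrite /chain_state jump_chainE//.
by rewrite -(constant_before_jump nt tn) fi /= ltnNge ia.
Qed.

Lemma passage_hits f a : minimal_cadlag_path f -> (first_passage f a < +oo)%E ->
  exists N, hits_at f a N.
Proof.
move=> hf /ereal_inf_lt[_ [t [t0 tz [i fi ia]] <-] _].
have [n /andP[nt tn]] := jump_interval hf t0 tz.
have nfin : (jump_time f n < +oo)%E by rewrite (le_lt_trans nt)// ltry.
have na : (chain_state f n <= a)%N.
  by rewrite /chain_state jump_chainE// -(constant_before_jump nt tn) fi.
have [N Na Nmin] := ex_minnP (ex_intro (fun n => chain_state f n <= a)%N n na).
exists N; split=> // k kN; rewrite ltnNge; apply/negP => /Nmin.
by rewrite leqNgt kN.
Qed.

Lemma hold_ge0 f n : 0 <= hold f n.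
Proof.
rewrite /hold /holding_time; case: eqP => // /eqP h; apply: fine_ge0.
rewrite sube_ge0 ?jump_time_le// ge0_fin_numE ?jump_time_ge0//.
by rewrite lt_neqAle h leey.
Qed.

Lemma area_upto_jump f n : minimal_cadlag_path f -> (jump_time f n < +oo)%E ->
  measurable_fun `[0, fine (jump_time f n)[ (fun s => state_value R (f s)) /\
  (\int[@lebesgue_measure R]_(s in `[0%R, fine (jump_time f n)[)
     state_value R (f s))%E = (\sum_(k < n) (chain_state f k)%:R * hold f k)%:E.
Proof.
move=> hf; elim: n => [|n IH] n1.
  rewrite /jump_time /= set_itvco0 big_ord0 integral_set0; split=> //.
  exact: measurable_fun_set0.
have n0 := le_lt_trans (jump_time_le f n) n1.
have [mIH iIH] := IH n0.
set t := fine (jump_time f n) in mIH iIH *; set u := fine (jump_time f n.+1).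
have t0 : 0 <= t by exact: fine_jump_time_ge0.
have tu : t <= u by rewrite -lee_fin -!jump_time_fin// jump_time_le.
have fE s : s \in `[t, u[ -> state_value R (f s) = (chain_state f n)%:R%:E.
  rewrite in_itv /= => /andP[ts su].
  have ns : (jump_time f n <= s%:E)%E by rewrite (jump_time_fin n0) lee_fin.
  have sn : (s%:E < jump_time f n.+1)%E by rewrite (jump_time_fin n1) lte_fin.
  by rewrite (constant_before_jump ns sn) -jump_chainE// jump_chain_Some.
have U : `[0, u[%classic = `[0, t[ `|` `[t, u[ :> set R.
  by rewrite -itv_bndbnd_setU// bnd_simp.
have mc : measurable_fun `[t, u[ (fun s => state_value R (f s)).
  apply: (eq_measurable_fun (fun=> (chain_state f n)%:R%:E)).
    by move=> s /set_mem /fE ->.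
  exact: measurable_cst.
have mU : measurable_fun (`[0, t[ `|` `[t, u[) (fun s => state_value R (f s)).
  by apply/measurable_funU.
split; first by rewrite U.
rewrite U ge0_integral_setU//=; first last.
- by apply/disj_set2P; rewrite -subset0 => s /= []; rewrite !in_itv /=; lra.
- by move=> s _; case: (f s) => //= m; rewrite ?lee_fin ?leey.
rewrite iIH big_ord_recr /= EFinD; congr (_ + _)%E.
transitivity (\int[@lebesgue_measure R]_(s in `[t, u[) (chain_state f n)%:R%:E)%E.
  by apply: eq_integral => s /set_mem /fE.
rewrite integral_cst//= lebesgue_measure_itv/= lte_fin.
have -> : hold f n = u - t.
  rewrite /hold /holding_time lt_eqF// /u /t.
  move: (jump_time_fin n0) (jump_time_fin n1).
  by move: (fine (jump_time f n)) (fine (jump_time f n.+1)) => t' u' -> ->.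
case: ltP => ut; first by rewrite -EFinD -EFinM.
by rewrite (_ : u = t) ?subrr ?mule0 ?mulr0//; lra.
Qed.

Lemma hits_at_area f a N : minimal_cadlag_path f -> hits_at f a N ->
  path_area f (first_passage f a) =
    (\sum_(k < N) (chain_state f k)%:R * hold f k)%:E.
Proof.
move=> hf hN; have Nfin := hits_at_finite hf hN.
have [mA <-] := area_upto_jump hf Nfin.
rewrite (hits_at_passage hf hN) -jump_time_sum// /path_area jump_time_fin//.
rewrite integral_itv_bndo_bndc//; congr (integral _ _ _).
by apply/seteqP; split=> s /=; rewrite in_itv /= lee_fin => /andP.
Qed.

End Paths.

(** * Measurability of the jump chain and of the holding times *)

Section Measurability.
Context d (T : measurableType d) (R : realType).

Lemma measurable_exists (I : countType) (F : I -> set T) :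
  (forall i, measurable (F i)) -> measurable [set w | exists i, F i w].
Proof.
move=> mF; rewrite [X in measurable X](_ : _ = \bigcup_i F i).
  exact: countable_bigcupT_measurable.
by apply/seteqP; split => w [i]; [exists i|move=> _ ?; exists i].
Qed.

Lemma measurable_forall (I : countType) (F : I -> set T) :
  (forall i, measurable (F i)) -> measurable [set w | forall i, F i w].
Proof.
move=> mF; rewrite [X in measurable X](_ : _ =
    ~` [set w | exists i, (~` F i) w]).
  by apply: measurableC; apply: measurable_exists => i; exact: measurableC.
apply/seteqP; split => w /= h; first by move=> [i]; apply.
by move=> i; apply: contrapT => Fi; apply: h; exists i.
Qed.

Lemma measurable_implies (A B : set T) : measurable A -> measurable B ->
  measurable [set w | A w -> B w].
Proof.
move=> mA mB; rewrite [X in measurable X](_ : _ = ~` A `|` B).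
  by apply: measurableU => //; exact: measurableC.
by apply/seteqP; split => w /= h; have [] := pselect (A w); tauto.
Qed.

Variable X : R -> T -> option nat.
Hypothesis mX : forall (t : R) (i : option nat), 0 <= t ->
  measurable [set w | X t w = i].
Hypothesis hX : forall w, minimal_cadlag_path (X ^~ w).

Let J n w := jump_time (X ^~ w) n.

(** A right-continuous path takes the value i at time J iff it does so at all
    rational times in some interval (J, J + 1/m). *)
Lemma measurable_state_at_jump n i :
  measurable_fun setT (J n) ->
  measurable [set w | (J n w < +oo)%E /\ X (fine (J n w)) w = i].
Proof.
move=> mJ.
have mlt (y : \bar R) : measurable [set w | (J n w < y)%E].
  by rewrite -[X in measurable X]setTI; exact: emeasurable_fun_infty_o.
have mgt (y : \bar R) : measurable [set w | (y < J n w)%E].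
  by rewrite -[X in measurable X]setTI; exact: emeasurable_fun_o_infty.
rewrite [Y in measurable Y](_ : _ = [set w | (J n w < +oo)%E] `&`
   [set w | exists m : nat, forall s : rat, (J n w < (ratr s)%:E)%E ->
     ((ratr s - m.+1%:R^-1)%:E < J n w)%E -> X (ratr s) w = i]).
  apply: measurableI; first exact: mlt.
  apply: measurable_exists => m; apply: measurable_forall => s.
  have [s0|s0] := leP 0 (ratr s : R).
    exact: (measurable_implies (mlt _) (measurable_implies (mgt _) (mX _ s0))).
  rewrite [Y in measurable Y](_ : _ = setT)//.
  apply/seteqP; split => // w _ /= Js.
  have := lt_trans Js (_ : _ < 0%:E)%E; rewrite lte_fin => /(_ s0).
  by rewrite ltNge jump_time_ge0.
apply/seteqP; split => w /=.
- move=> [Jfin JX]; split=> //.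
  have [e e0 he] := rc_interval (hX w) (fine_jump_time_ge0 (X ^~ w) n).
  exists (Num.truncn e^-1) => s; rewrite /J (jump_time_fin Jfin) !lte_fin => Js sJ.
  rewrite he ?ltW// (lt_trans (_ : _ < fine (J n w) + (Num.truncn e^-1).+1%:R^-1))//.
    by rewrite -ltrBlDr.
  rewrite ltrD2l -[ltRHS]invrK ltf_pV2 ?posrE ?invr_gt0//.
  by rewrite truncnS_gt.
- move=> [Jfin [m hm]]; split=> //.
  have [e e0 he] := rc_interval (hX w) (fine_jump_time_ge0 (X ^~ w) n).
  have m0 : 0 < (m.+1%:R^-1 : R) by rewrite invr_gt0.
  have [|s] := @rat_in_itvoo R (fine (J n w))
    (Num.min (fine (J n w) + e) (fine (J n w) + m.+1%:R^-1)).
    by rewrite lt_min !ltrDl e0.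
  rewrite in_itv /= lt_min => /and3P[Js se sm].
  rewrite -(he (ratr s)) ?ltW//.
  by apply: hm; rewrite /J (jump_time_fin Jfin) lte_fin// ltrBlDr.
Qed.

(** The next jump occurs before c iff at some rational time before c the path
    has left its current state. *)
Lemma measurable_jump_time n : measurable_fun setT (J n).
Proof.
elim: n => [|n IH]; first exact: measurable_cst.
apply: (measurability _ (ErealGenInftyO.measurableE R)) => //.
move=> _ [_ [c ->] <-]; rewrite setTI.
have mlt (y : \bar R) : measurable [set w | (J n w < y)%E].
  by rewrite -[X in measurable X]setTI; exact: emeasurable_fun_infty_o.
rewrite [Y in measurable Y](_ : _ = [set w | exists s : rat, exists i : option nat,
   [/\ (J n w < (ratr s)%:E)%E, ratr s < c,
     (J n w < +oo)%E /\ X (fine (J n w)) w = i & X (ratr s) w <> i]]).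
  apply: measurable_exists => s; apply: measurable_exists => i.
  have [s0|s0] := leP 0 (ratr s : R); last first.
    rewrite [Y in measurable Y](_ : _ = set0)//.
    rewrite -subset0 => w /= [Js _ _ _].
    have := lt_trans Js (_ : _ < 0%:E)%E; rewrite lte_fin => /(_ s0).
    by rewrite ltNge jump_time_ge0.
  have [sc|sc] := ltP (ratr s : R) c; last first.
    rewrite [Y in measurable Y](_ : _ = set0)//.
    by rewrite -subset0 => w /= [].
  rewrite [Y in measurable Y](_ : _ = [set w | (J n w < (ratr s)%:E)%E] `&`
    ([set w | (J n w < +oo)%E /\ X (fine (J n w)) w = i] `&`
     ~` [set w | X (ratr s) w = i])).
    apply: measurableI => //; apply: measurableI; last exact/measurableC/mX.
    exact: measurable_state_at_jump.
  by apply/seteqP; split => w /=; [case|move=> [? [? ?]]].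
apply/seteqP; split => w /=; rewrite in_itv /=.
- move=> Jc; have Jfin : (J n w < +oo)%E.
    by rewrite (le_lt_trans (jump_time_le _ _))// (lt_trans Jc)// ltry.
  have [_ [t [Jt ft] <-]] := ereal_inf_lt Jc.
  rewrite lte_fin => tc.
  have t0 : 0 <= t by rewrite -lee_fin (le_trans _ Jt)// jump_time_ge0.
  have [e e0 he] := rc_interval (hX w) t0.
  have [|s] := @rat_in_itvoo R t (Num.min (t + e) c).
    by rewrite lt_min ltrDl e0.
  rewrite in_itv /= lt_min => /and3P[ts se sc].
  exists s, (X (fine (J n w)) w); split => //.
    by rewrite (le_lt_trans Jt)// lte_fin.
  by rewrite (he (ratr s)) ?ltW.
- move=> [s [i [Js sc [Jfin JX] Xs]]].
  apply: (@le_lt_trans _ _ (ratr s)%:E); last by rewrite lte_fin.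
  by apply: ereal_inf_lbound; exists (ratr s) => //; split; [exact: ltW|rewrite JX].
Qed.

Lemma measurable_chain_state n i :
  measurable [set w | chain_state (X ^~ w) n = i].
Proof.
have E w m j : chain_state (X ^~ w) m = j <-> jump_chain (X ^~ w) m = Some j.
  by rewrite jump_chain_Some//; split => [->|[]].
elim: n => [|n IH].
  rewrite [Y in measurable Y](_ : _ = [set w | X 0 w = Some i]); first exact: mX.
  by apply/seteqP; split => w /= => [/E//|h]; apply/E.
rewrite [Y in measurable Y](_ : _ =
   ([set w | J n.+1 w = +oo%E] `&` [set w | chain_state (X ^~ w) n = i]) `|`
   [set w | (J n.+1 w < +oo)%E /\ X (fine (J n.+1 w)) w = Some i]).
  apply: measurableU; last exact/measurable_state_at_jump/measurable_jump_time.
  apply: measurableI => //.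
  rewrite -[Y in measurable Y]setTI.
  exact: (measurable_jump_time n.+1 _ (emeasurable_set1 _)).
apply/seteqP; split => w /=.
  move/E; rewrite jump_chainS; case: eqP => [Jy /E|/eqP Jy]; first by left.
  by right; rewrite lt_neqAle Jy leey.
move=> h; apply/E; rewrite jump_chainS -/(J n.+1 w); case: h => [[-> /E]|[]].
  by rewrite eqxx.
by rewrite lt_neqAle => /andP[/negPf -> _].
Qed.

Lemma measurable_hold n : measurable_fun setT (fun w => hold (X ^~ w) n).
Proof.
apply: (measurableT_comp (fine_measurable measurableT)).
apply: measurable_fun_ifT => //.
  apply: (measurable_fun_bool true) => /=.
  rewrite [Y in measurable Y](_ : _ = [set w | J n w = +oo%E]).
    rewrite -[Y in measurable Y]setTI.
    exact: (measurable_jump_time n _ (emeasurable_set1 _)).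
  by apply/seteqP; split => w /= => [[_ /eqP//]|h]; split => //; apply/eqP.
exact: (emeasurable_funB (measurable_jump_time n.+1) (measurable_jump_time n)).
Qed.

Lemma measurable_hits_at a N : measurable [set w | hits_at (X ^~ w) a N].
Proof.
have mlt n : measurable [set w | (chain_state (X ^~ w) n <= a)%N].
  rewrite [Y in measurable Y](_ : _ =
    \bigcup_(i in [set i | (i <= a)%N]) [set w | chain_state (X ^~ w) n = i]).
    by apply: bigcup_measurable => i _; exact: measurable_chain_state.
  by apply/seteqP; split => w /= => [h|[i /= ia -> //]]; exists (chain_state (X ^~ w) n).
apply: measurableI; last exact: mlt.
apply: measurable_forall => k.
rewrite [Y in measurable Y](_ : _ = if (k < N)%N then
    ~` [set w | (chain_state (X ^~ w) k <= a)%N] else setT).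
  by case: ifP => // _; exact: measurableC.
apply/seteqP; split => w /=; case: ifP => // _ /=.
  by rewrite ltnNge => /(_ erefl)/negP.
by move=> /negP; rewrite -ltnNge.
Qed.

End Measurability.

(** * Laplace transforms from exponential tails *)

Section LaplaceFromTail.
Variable R : realType.
Local Notation leb := (@lebesgue_measure R).

Lemma adde_eq_EFin (I : \bar R) (x y : R) :
  (I + x%:E = y%:E)%E -> I = (y - x)%:E.
Proof. by case: I => // i [<-]; rewrite addrK. Qed.

Lemma exponential_tail (t u : R) : 0 < t ->
  (\int[leb]_(s in `[u, +oo[) (t * expR (- (t * s)))%:E = (expR (- (t * u)))%:E)%E.
Proof.
move=> t0.
have dE (s : R) : is_derive s 1 (fun s => - expR (- (t * s))) (t * expR (- (t * s))).
  apply: is_derive_eq; rewrite /GRing.scale /=; ring.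
rewrite (@ge0_continuous_FTC2y _ _ (fun s => - expR (- (t * s))) u 0).
- by rewrite -EFinB sub0r opprK.
- by move=> s _; rewrite mulr_ge0 ?ltW ?expR_gt0.
- apply: continuous_subspaceT => s; apply: cvgMl_tmp.
  apply: (@continuous_comp _ _ _ (fun s => - (t * s)) expR).
    by apply: cvgN; apply: cvgMl_tmp; exact: cvg_id.
  exact: continuous_expR.
- rewrite -oppr0; apply: cvgN.
  apply: (@cvg_comp _ _ _ (fun s => t * s) (fun s => expR (- s)) _ +oo%R); last first.
    exact: cvgr_expR.
  by apply: gt0_cvgMry => //; exact: cvg_id.
- by move=> s _; have [] := dE s.
- apply: cvg_at_right_filter.
  have /derivable1_diffP/differentiable_continuous :
    derivable (fun s => - expR (- (t * s))) u 1 by have [] := dE u.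
  exact.
- by move=> s _; rewrite derive1E; have [] := dE s.
Qed.

Lemma measurable_exp_lin (k : R) :
  measurable_fun setT (fun s : R => expR (- (k * s))).
Proof.
apply: (measurableT_comp (@measurable_expR R)).
under eq_fun do rewrite -mulNr.
exact: measurable_funM.
Qed.

Lemma exponential_mixture (t c C : R) : 0 < t -> 0 < c -> 0 <= C ->
  (\int[leb]_(s in `[0%R, +oo[) (t * expR (- (t * s)) * (C - C * expR (- (c * s))))%:E
    = (C * (c / (c + t)))%:E)%E.
Proof.
move=> t0 c0 C0.
pose e k (s : R) : R := expR (- (k * s)).
have me k : measurable_fun (`[0, +oo[ : set R) (e k).
  by apply: measurable_funTS; exact: measurable_exp_lin.
have mi k : measurable_fun (`[0, +oo[ : set R) (fun s => k * e k s).
  exact: measurable_funM.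
set I := (LHS).
have : (I + (C * (t / (c + t)))%:E = C%:E)%E.
  have -> : ((C * (t / (c + t)))%:E =
    \int[leb]_(s in `[0%R, +oo[) ((C * (t / (c + t)))%:E * ((c + t) * e (c + t) s)%:E))%E.
    rewrite ge0_integralZl_EFin//.
    - by rewrite exponential_tail ?addr_gt0// mulr0 oppr0 expR0 mule1.
    - by move=> s _; rewrite lee_fin mulr_ge0 ?expR_ge0 ?addr_ge0 ?ltW.
    - by apply/measurable_EFinP; exact: mi.
    - by rewrite mulr_ge0// divr_ge0// ?addr_ge0 ?ltW.
  rewrite -ge0_integralD//.
  - transitivity (\int[leb]_(s in `[0%R, +oo[) (C%:E * (t * e t s)%:E))%E.
      apply: eq_integral => s _; rewrite -!EFinM -EFinD; congr EFin.
      have -> : e (c + t) s = expR (- (c * s)) * expR (- (t * s)).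
        by rewrite -expRD /e; congr expR; ring.
      by rewrite /e; field; lra.
    rewrite ge0_integralZl_EFin//.
    + by rewrite exponential_tail// mulr0 oppr0 expR0 mule1.
    + by move=> s _; rewrite lee_fin mulr_ge0 ?expR_ge0 ?ltW.
    + by apply/measurable_EFinP; exact: mi.
  - move=> s; rewrite /= in_itv /= andbT => s0.
    have es : expR (- (c * s)) <= 1 by rewrite -expR0 ler_expR oppr_le0 mulr_ge0// ltW.
    rewrite lee_fin; apply: mulr_ge0; first by rewrite mulr_ge0 ?expR_ge0 ?ltW.
    by rewrite subr_ge0 ler_piMr.
  - apply/measurable_EFinP; apply: measurable_funM; first exact: mi.
    apply: measurable_funB => //; apply: measurable_funM => //; exact: me.
  - move=> s _; rewrite lee_fin mulr_ge0//.
      by rewrite mulr_ge0// divr_ge0// ?addr_ge0 ?ltW.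
    by rewrite mulr_ge0 ?expR_ge0 ?addr_ge0 ?ltW.
  - by apply/measurable_EFinP; apply: measurable_funM => //; exact: mi.
by move=> /adde_eq_EFin ->; congr EFin; field; lra.
Qed.

Context d (T : measurableType d) (P : probability T R).

(** Since exp(-t H) is the integral of t exp(-t s) over s >= H, exchanging
    integrals reduces the Laplace transform of H under F dP to its tail. *)
Lemma laplace_from_tail (F H : T -> R) (C c t : R) :
  measurable_fun setT F -> measurable_fun setT H ->
  (forall w, 0 <= F w) -> (forall w, 0 <= H w) ->
  0 < c -> 0 <= t -> 0 <= C ->
  (\int[P]_w (F w)%:E = C%:E)%E ->
  (forall s, 0 <= s ->
     (\int[P]_w (if s < H w then F w else 0)%:E = (C * expR (- (c * s)))%:E)%E) ->
  (\int[P]_w (F w * expR (- (t * H w)))%:E = (C * (c / (c + t)))%:E)%E.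
Proof.
move=> mF mH F0 H0 c0 t0 C0 FC tail.
have [t00|tN0] := eqVneq t 0.
  rewrite t00 addr0 divff ?gt_eqF// mulr1 -FC.
  by apply: eq_integral => w _; rewrite mul0r oppr0 expR0 mulr1.
have {tN0}t0 : 0 < t by rewrite lt_neqAle eq_sym tN0.
pose f (z : T * R) : \bar R :=
  (if H z.1 <= z.2 then F z.1 * (t * expR (- (t * z.2))) else 0)%:E.
have mF1 : measurable_fun setT (fun z : T * R => F z.1).
  exact: measurableT_comp.
have mH1 : measurable_fun setT (fun z : T * R => H z.1).
  exact: measurableT_comp.
have mf : measurable_fun setT f.
  apply/measurable_EFinP; apply: measurable_fun_ifT => //.
    exact: measurable_fun_ler.
  apply: measurable_funM => //; apply: measurable_funM => //.
  exact: (measurableT_comp (measurable_exp_lin t)).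
have f0 z : (0 <= f z)%E.
  by rewrite lee_fin; case: ifP => // _; rewrite mulr_ge0 ?mulr_ge0 ?expR_ge0 ?(ltW t0).
transitivity (\int[P]_w \int[leb]_s f (w, s))%E.
  apply: eq_integral => w _; rewrite EFinM -exponential_tail// -ge0_integralZl_EFin//.
  - rewrite integral_mkcond; apply: eq_integral => s _.
    rewrite patchE /f /=; case: ifPn.
      by rewrite inE /= in_itv /= andbT => ->.
    by rewrite notin_setE /= in_itv /= andbT => /negP/negPf ->.
  - by move=> s _; rewrite lee_fin mulr_ge0 ?expR_ge0 ?ltW.
  - apply/measurable_EFinP; apply: measurable_funM => //.
    exact: measurable_funTS (measurable_exp_lin t).
rewrite fubini_tonelli// -exponential_mixture// [RHS]integral_mkcond.
apply: eq_integral => s _; rewrite patchE; case: ifPn; last first.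
  rewrite notin_setE /= in_itv /= andbT => /negP; rewrite -ltNge => s0.
  rewrite integral0_eq// => w _; rewrite /f /= leNgt (lt_le_trans s0)//.
rewrite inE /= in_itv /= andbT => s0.
have e0 : 0 <= t * expR (- (t * s)) by rewrite mulr_ge0 ?expR_ge0 ?ltW.
have mtail : measurable_fun setT (fun w => if s < H w then F w else 0).
  by apply: measurable_fun_ifT => //; exact: measurable_fun_ltr.
have mhead : measurable_fun setT (fun w => if H w <= s then F w else 0).
  by apply: measurable_fun_ifT => //; exact: measurable_fun_ler.
transitivity (\int[P]_w ((t * expR (- (t * s)))%:E *
   (if (H w <= s)%R then F w else 0)%:E))%E.
  apply: eq_integral => w _; rewrite /f /=.
  by case: ifP => _; rewrite -EFinM ?mulr0// mulrC.
rewrite ge0_integralZl_EFin//; first last.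
- exact/measurable_EFinP.
- by move=> w _; rewrite lee_fin; case: ifP.
rewrite [RHS]EFinM; congr (_ * _)%E.
have : (\int[P]_w (if (H w <= s)%R then F w else 0)%:E +
        (C * expR (- (c * s)))%:E = C%:E)%E.
  rewrite -tail// -FC -ge0_integralD//; first last.
  - exact/measurable_EFinP.
  - by move=> w _; rewrite lee_fin; case: ifP.
  - exact/measurable_EFinP.
  - by move=> w _; rewrite lee_fin; case: ifP.
  by apply: eq_integral => w _; rewrite ltNge; case: ifP => _ /=; rewrite ?adde0 ?add0e.
set I := integral _ _ _.
by move=> /adde_eq_EFin ->; congr EFin; ring.
Qed.

End LaplaceFromTail.

(** * First passage of a discrete chain *)

(** For a transition matrix K, the probability that the chain started at i first
    visits {0, ..., a} at time n. *)
Fixpoint passage_weight (R : realType) (K : nat -> nat -> R) (a n i : nat)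
    : \bar R :=
  (if n is m.+1 then
     if (i <= a)%N then 0
     else \sum_(0 <= j <oo) ((K i j)%:E * passage_weight K a m j)
   else (if (i <= a)%N then 1 else 0))%E.

Lemma passage_weight_ge0 (R : realType) (K : nat -> nat -> R) (a n i : nat) :
  (forall i j, 0 <= K i j) -> (0 <= passage_weight K a n i)%E.
Proof.
move=> K0; elim: n i => [|n IH] i /=; first by case: ifP.
case: ifP => // _; apply: nneseries_ge0 => j _ _.
by rewrite mule_ge0// lee_fin.
Qed.

Lemma passage_weight_mono (R : realType) (K L : nat -> nat -> R) (a n i : nat) :
  (forall i j, 0 <= K i j) -> (forall i j, K i j <= L i j) ->
  (passage_weight K a n i <= passage_weight L a n i)%E.
Proof.
move=> K0 KL; elim: n i => [|n IH] i //=.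
case: ifP => // _; apply: lee_nneseries => [j _ _|j _].
  by rewrite mule_ge0 ?lee_fin// passage_weight_ge0.
apply: lee_pmul; rewrite ?lee_fin ?K0 ?KL ?IH//.
exact: passage_weight_ge0.
Qed.

Definition passage_value (R : realType) (K : nat -> nat -> R) (a i : nat)
  : \bar R := (\sum_(0 <= n <oo) passage_weight K a n i)%E.

Lemma passage_value_absorbed (R : realType) (K : nat -> nat -> R) (a i : nat) :
  (forall i j, 0 <= K i j) -> (i <= a)%N -> passage_value K a i = 1%E.
Proof.
move=> K0 ia; rewrite /passage_value (@nneseriesD1 _ _ 0%N)//=; last first.
  by move=> k _; exact: passage_weight_ge0.
rewrite ia eseries0 ?adde0// => -[|k]//= _ _.
by rewrite ia.
Qed.


Lemma passage_value_step (R : realType) (K : nat -> nat -> R) (a i : nat) :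
  (forall i j, 0 <= K i j) -> (a < i)%N ->
  passage_value K a i = (\sum_(0 <= j <oo) (K i j)%:E * passage_value K a j)%E.
Proof.
move=> K0 ai; rewrite /passage_value.
have w0 m j : (0 <= passage_weight K a m j)%E by exact: passage_weight_ge0.
rewrite nneseries_recl//= leqNgt ai /= add0e -nneseries_addn//.
under eq_eseriesr do rewrite addn1 /= leqNgt ai /=.
rewrite nneseries_interchange; last first.
  by move=> m j; rewrite mule_ge0// lee_fin.
by apply: eq_eseriesr => j _; rewrite nneseriesZl.
Qed.

(** The passage value is the minimal nonnegative solution of the first-step
    equations: a superharmonic function dominates the contribution of the first n
    steps, by induction on n. *)
Lemma passage_value_le (R : realType) (K : nat -> nat -> R) (a : nat)
    (h : nat -> R) :
  (forall i j, 0 <= K i j) ->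
  (forall i j, (a < i)%N -> (j.+1 < i)%N -> K i j = 0) ->
  (forall i, 0 <= h i) -> 1 <= h a ->
  (forall i, (a < i)%N -> (\sum_(0 <= j <oo) (K i j * h j)%:E <= (h i)%:E)%E) ->
  forall x, (a <= x)%N -> (passage_value K a x <= (h x)%:E)%E.
Proof.
move=> K0 Kskip h0 ha hh.
have w0 m j : (0 <= passage_weight K a m j)%E by exact: passage_weight_ge0.
suff H n x : (a <= x)%N ->
    (\sum_(0 <= k < n.+1) passage_weight K a k x <= (h x)%:E)%E.
  move=> x ax; apply: lime_le; first exact: is_cvg_nneseries.
  apply: nearW => -[|n]; last exact: H.
  by rewrite big_geq// lee_fin.
elim: n x => [|n IH] x.
  move=> ax; rewrite big_nat1 /=.
  case: ifPn => [xa|_]; last by rewrite lee_fin.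
  by have -> : x = a by apply/eqP; rewrite eqn_leq ax xa.
rewrite leq_eqVlt => /orP[/eqP <-|ax].
  rewrite big_nat_recl//= leqnn big1 ?adde0// ?lee_fin//.
rewrite big_nat_recl//= leqNgt ax /= add0e.
rewrite -nneseries_sum_nat; last by move=> k j; rewrite mule_ge0// lee_fin.
apply: le_trans (hh _ ax).
apply: lee_nneseries => [j _ _|j _].
  by apply: sume_ge0 => k _; rewrite mule_ge0// lee_fin.
case: (ltnP j.+1 x) => jx.
  rewrite Kskip// mul0r big1// => k _.
  by rewrite mul0e.
rewrite -ge0_sume_distrr//.
rewrite EFinM lee_wpmul2l ?lee_fin//.
by apply: IH; rewrite -ltnS (leq_trans ax).
Qed.

(** A maximum principle: the difference between h and the passage value is
    nonnegative, vanishes at a and at infinity, so if it is not identically 0 it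
    has a smallest maximizer y > a; as K is substochastic and the chain can step
    down from y to y - 1, where the difference is smaller, the equation at y is
    violated. *)
Lemma passage_value_harmonic (R : realType) (K : nat -> nat -> R) (a : nat)
    (h : nat -> R) :
  (forall i j, 0 <= K i j) ->
  (forall i j, (a < i)%N -> (j.+1 < i)%N -> K i j = 0) ->
  (forall i, (a < i)%N -> 0 < K i i.-1) ->
  (forall i, (a < i)%N -> (\sum_(0 <= j <oo) (K i j)%:E <= 1)%E) ->
  (forall i, 0 <= h i) -> h a = 1 -> h @ \oo --> (0 : R) ->
  (forall i, (a < i)%N -> (\sum_(0 <= j <oo) (K i j * h j)%:E = (h i)%:E)%E) ->
  forall x, (a <= x)%N -> passage_value K a x = (h x)%:E.
Proof.
move=> K0 Kskip Kdown Ksub h0 ha hlim hh.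
have uh x : (a <= x)%N -> (passage_value K a x <= (h x)%:E)%E.
  by apply: passage_value_le => // [|i /hh ->//]; rewrite ha.
have u0 x : (0 <= passage_value K a x)%E.
  by apply: nneseries_ge0 => *; exact: passage_weight_ge0.
have ufin x : (a <= x)%N -> passage_value K a x \is a fin_num.
  by move=> ax; rewrite ge0_fin_numE// (le_lt_trans (uh _ ax))// ltry.
pose f x := h x - fine (passage_value K a x).
have uE x : (a <= x)%N -> passage_value K a x = (h x - f x)%:E.
  by move=> ax; rewrite /f opprB addrC subrK fineK// ufin.
have fa : f a = 0 by rewrite /f ha passage_value_absorbed //= subrr.
have fh x : f x <= h x.
  by rewrite /f lerBlDr lerDl fine_ge0.
suff f0 x : (a <= x)%N -> f x <= 0.
  move=> x ax; apply/eqP; rewrite eq_le uh //= uE// lee_fin.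
  by rewrite lerBrDr gerDl f0.
move=> ax; rewrite leNgt; apply/negP => fx.
have [N _ fN] : \forall n \near \oo, h n < f x.
  by apply: (cvgr_lt 0).
have ubN j : (N <= j)%N -> f j < f x.
  by move=> Nj; apply: le_lt_trans (fh _) (fN _ Nj).
have xN : (x < N)%N by rewrite ltnNge; apply/negP => /ubN; rewrite ltxx.
pose g (j : 'I_N) := f j.
pose P := [pred j : 'I_N | (a <= j)%N].
have Px : P (Ordinal xN) by [].
have [j0 Pj0 j0max] := @Order.TotalTheory.arg_maxP _ _ 'I_N (Ordinal xN) P g Px.
have maxE j : (a <= j)%N -> f j <= f j0.
  move=> aj; case: (ltnP j N) => jN.
    exact: (j0max (Ordinal jN)).
  by apply: (le_trans (ltW (ubN _ jN))); exact: (j0max (Ordinal xN)).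
have exM : exists j, (a <= j)%N && (f j == f j0) by exists j0; rewrite eqxx andbT.
pose y := ex_minn exM.
have [ay fy ymin] : [/\ (a <= y)%N, f y = f j0
    & forall j, (a <= j)%N -> f j = f j0 -> (y <= j)%N].
  rewrite /y; case: ex_minnP => z /andP[az /eqP fz] zmin; split=> // j aj fj.
  by apply: zmin; rewrite aj fj eqxx.
have fy0 : 0 < f y by rewrite fy (lt_le_trans fx)// maxE.
have {}ay : (a < y)%N.
  rewrite ltn_neqAle ay andbT; apply/eqP => aE.
  by move: fy0; rewrite -aE fa ltxx.
have yy : y.-1.+1 = y by rewrite prednK// (leq_ltn_trans _ ay).
have ay1 : (a <= y.-1)%N by rewrite -ltnS yy.
have f1 : f y.-1 < f y.
  rewrite lt_neqAle fy maxE// andbT; apply/eqP => /(ymin _ ay1).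
  by rewrite -{1}yy ltnn.
pose e := K y y.-1 * (f y - f y.-1).
have e0 : 0 < e by rewrite mulr_gt0// ?Kdown// subr_gt0.
have : ((h y + e)%:E <= (h y)%:E)%E.
  rewrite [leRHS](_ : _ = (h y - f y)%:E + (f y)%:E)%E; last first.
    by rewrite -EFinD subrK.
  rewrite EFinD -hh// -uE ?(ltnW ay)// passage_value_step//.
  have -> : e%:E = (\sum_(0 <= j <oo) (if j == y.-1 then e else 0)%:E)%E.
    rewrite (@nneseriesD1 _ _ y.-1)//= ?eqxx ?eseries0 ?adde0// => j _.
      by move=> /negPf ->.
    by rewrite lee_fin; case: ifP => // _; exact: ltW.
  rewrite -nneseriesD//; first last.
    - by move=> j _ _; rewrite lee_fin; case: ifP => // _; exact: ltW.
    - by move=> j _ _; rewrite lee_fin mulr_ge0.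
  apply: (@le_trans _ _ (\sum_(0 <= j <oo) (K y j)%:E * passage_value K a j +
                         \sum_(0 <= j <oo) (f y)%:E * (K y j)%:E))%E; last first.
    rewrite leeD2l// nneseriesZl; last by move=> j _; rewrite lee_fin.
    rewrite -[leRHS]mule1 lee_wpmul2l ?lee_fin ?(ltW fy0)//.
    exact: Ksub.
  rewrite -nneseriesD//; first last.
    - by move=> j _ _; rewrite mule_ge0 ?lee_fin// ltW.
    - by move=> j _ _; rewrite mule_ge0 ?lee_fin.
  apply: lee_nneseries => [j _ _|j _].
    rewrite adde_ge0// lee_fin ?mulr_ge0//.
    by case: ifP => // _; exact: ltW.
  case: (ltnP j.+1 y) => jy.
    rewrite Kskip// !mul0r mul0e mule0 ifN ?adde0//.
    by apply/eqP => jE; move: jy; rewrite jE yy ltnn.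
  have aj : (a <= j)%N by rewrite -ltnS (leq_trans ay).
  rewrite uE// -!EFinM -!EFinD lee_fin.
  have := maxE _ aj; rewrite -fy => fjy.
  case: eqP => [jE|_].
    rewrite /e jE; lra.
  have := ler_wpM2l (K0 y j) fjy; lra.
by rewrite lee_fin gerDl leNgt e0.
Qed.

(** * The passage transform of a Markov chain *)

(** The jump probability from i to j times the Laplace transform, at theta i, of
    an exponential holding time of rate - Q i i. *)
Definition discounted_kernel (R : realType) (Q : nat -> nat -> R) (theta : nat -> R)
    (i j : nat) : R :=
  jump_matrix Q i j * (- Q i i / (- Q i i + theta i)).

Section PassageTransform.
Context d (T : measurableType d) (R : realType) (P : probability T R).
Variables (X : R -> T -> option nat) (Q : nat -> nat -> R) (x a : nat).
Variable theta : nat -> R.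
Hypothesis mX : forall (t : R) (i : option nat), 0 <= t ->
  measurable [set w | X t w = i].
Hypothesis hX : forall w, minimal_cadlag_path (X ^~ w).
Hypothesis hY : forall (n : nat) (i : nat -> nat),
  P [set w | forall k, (k <= n)%N -> jump_chain (X ^~ w) k = Some (i k)] =
  ((i 0%N == x)%:R * \prod_(k < n) jump_matrix Q (i k) (i k.+1))%:E.
Hypothesis hH : forall (n : nat) (i : nat -> nat) (s : nat -> R),
  (forall k, 0 <= s k) ->
  P [set w | forall k, (k <= n)%N ->
      jump_chain (X ^~ w) k = Some (i k) /\
      ((s k)%:E < holding_time (X ^~ w) k)%E] =
  (P [set w | forall k, (k <= n)%N -> jump_chain (X ^~ w) k = Some (i k)] *
   (\prod_(k < n.+1) expR (Q (i k) (i k) * s k))%:E)%E.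
Hypothesis Q0 : forall i, (a < i)%N -> Q i i < 0.
Hypothesis Qle0 : forall i, Q i i <= 0.
Hypothesis theta0 : forall i, 0 <= theta i.
Hypothesis J0 : forall i j, 0 <= jump_matrix Q i j.

Let Y n w := chain_state (X ^~ w) n.
Let H n w : R := hold (X ^~ w) n.

Let mY n : measurable_fun setT (Y n).
Proof.
move=> _ B _; rewrite setTI.
rewrite [Z in measurable Z](_ : _ = \bigcup_(i in B) [set w | Y n w = i]).
  by apply: bigcup_measurable => i _; exact: measurable_chain_state.
by apply/seteqP; split => w /= => [h|[i /= Bi -> //]]; exists (Y n w).
Qed.

Let mH n : measurable_fun setT (H n).
Proof. exact: measurable_hold. Qed.

Let path_event n (i : nat -> nat) : set T :=
  [set w | forall k, (k <= n)%N -> Y k w = i k].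

Let path_eventE n i : path_event n i =
  [set w | forall k, (k <= n)%N -> jump_chain (X ^~ w) k = Some (i k)].
Proof.
apply/seteqP; split => w h k kn; first by rewrite jump_chain_Some// -(h k kn).
by rewrite /Y /chain_state h.
Qed.

Let m_path_event n i : measurable (path_event n i).
Proof.
apply: measurable_forall => // k.
rewrite [Z in measurable Z](_ : _ = if (k <= n)%N then [set w | Y k w = i k] else setT).
  by case: ifP => // _; exact: measurable_chain_state.
by apply/seteqP; split => w /=; case: (k <= n)%N => //; apply.
Qed.

Let P_path_event n i : P (path_event n i) =
  ((i 0%N == x)%:R * \prod_(k < n) jump_matrix Q (i k) (i k.+1))%:E.
Proof. by rewrite path_eventE hY. Qed.

(** A chain that has stopped jumping repeats its state, which the condition on i
    rules out for the first N steps. *)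
Let hold_on_path N i w : (forall k, (k < N)%N -> i k != i k.+1) ->
  path_event N i w ->
  (forall k, (k < N)%N -> holding_time (X ^~ w) k = (H k w)%:E /\ 0 < H k w) /\
  (0 < holding_time (X ^~ w) N)%E.
Proof.
move=> iN Bw.
have J1 k : (k < N)%N -> (jump_time (X ^~ w) k.+1 < +oo)%E.
  move=> kN; rewrite lt_neqAle leey andbT; apply/eqP => JE.
  have := iN k kN; rewrite -(Bw k (ltnW kN)) -(Bw k.+1 kN) => /eqP; apply.
  by rewrite /Y /chain_state jump_chainS JE eqxx.
have J2 k : (k < N)%N -> (jump_time (X ^~ w) k < +oo)%E.
  by move=> /J1; apply: le_lt_trans; exact: jump_time_le.
have hpos k : (jump_time (X ^~ w) k < +oo)%E -> (0 < holding_time (X ^~ w) k)%E.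
  move=> Jk; rewrite /holding_time lt_eqF//.
  by rewrite sube_gt0 jump_time_lt.
split=> [k kN|]; last first.
  case: N iN Bw J1 J2 => [_ _ _ _|N _ _ J1 _]; first by apply: hpos; exact: ltry.
  by apply: hpos; exact: J1.
have E : holding_time (X ^~ w) k = (H k w)%:E.
  rewrite /H /hold fineK// /holding_time lt_eqF ?J2//.
  move: (jump_time_fin (J1 k kN)) (jump_time_fin (J2 k kN)) => -> ->.
  by rewrite -EFinB.
by split=> //; rewrite -lte_fin -E; apply: hpos; exact: J2.
Qed.

(** Interpolates between the joint tail of the holding times along a path, m = 0,
    and their joint Laplace transform, m = N. *)
Let mixed N (i : nat -> nat) (s : nat -> R) m w : R := \1_(path_event N i) w *
  \prod_(k < N) (if (k < m)%N then expR (- (theta (i k) * H k w))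
                 else if s k < H k w then 1 else 0).

Let m_mixed N (i : nat -> nat) (s : nat -> R) m : measurable_fun setT (mixed N i s m).
Proof.
apply: measurable_funM; first exact: measurable_indic.
apply: measurable_prod => k _; case: (k < m)%N.
  exact: (measurableT_comp (measurable_exp_lin (theta (i k))) (mH k)).
by apply: measurable_fun_ifT => //; apply: measurable_fun_ltr => //; exact: mH.
Qed.

Let prod_indicator N (b : 'I_N -> bool) :
  (\prod_(k < N) (if b k then 1 else 0) : R) = if [forall k, b k] then 1 else 0.
Proof.
have [/forallP h|] := boolP [forall k, b k]; last first.
  by rewrite negb_forall => /existsP[k /negPf kb]; rewrite (bigD1 k)//= kb mul0r.
by rewrite big1// => k _; rewrite h.
Qed.

(** One more holding time is transformed at each step, by laplace_from_tail
    applied to the factor that the others leave. *)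
Let mixed_integral N (i : nat -> nat) (s : nat -> R) m :
  (forall k, (k < N)%N -> i k != i k.+1) ->
  (forall k, (k < N)%N -> (a < i k)%N) -> (forall k, 0 <= s k) -> (m <= N)%N ->
  (\int[P]_w (mixed N i s m w)%:E = ((i 0%N == x)%:R *
     \prod_(k < N) jump_matrix Q (i k) (i k.+1) *
     \prod_(k < N) (if (k < m)%N then - Q (i k) (i k) / (- Q (i k) (i k) + theta (i k))
                    else expR (- (- Q (i k) (i k) * s k))))%:E)%E.
Proof.
move=> iN ai; elim: m s => [|m IH] s s0 mN.
  (* The bound 0 on the last holding time is no restriction. *)
  pose s' k := if (k < N)%N then s k else 0.
  have s'0 k : 0 <= s' k by rewrite /s'; case: ifP.
  have := hH N i s'0; rewrite hY -EFinM big_ord_recr /= /s' ltnn mulr0 expR0 mulr1.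
  set E := [set w | _] => PE.
  have EE w : (w \in E) = (w \in path_event N i) && [forall k : 'I_N, s k < H k w].
    apply/idP/andP => [/set_mem h|[/set_mem Bw /forallP h]].
      have Bw : path_event N i w by rewrite path_eventE => k /h[].
      split; [exact: mem_set|apply/forallP => k].
      have [/(_ k (ltn_ord k)) [hE _] _] := hold_on_path iN Bw.
      have [_] := h k (ltnW (ltn_ord k)); rewrite /s' ltn_ord.
      by rewrite hE lte_fin.
    apply/mem_set => k; rewrite leq_eqVlt => /orP[/eqP ->|kN].
      have [_ hN] := hold_on_path iN Bw; rewrite ltnn; split=> //.
      by rewrite jump_chain_Some//; congr Some; exact: Bw.
    have [/(_ k kN) [hE _] _] := hold_on_path iN Bw; rewrite kN hE lte_fin.
    split; last exact: (h (Ordinal kN)).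
    by rewrite jump_chain_Some//; congr Some; apply: Bw; exact: ltnW.
  have mE : measurable E.
    rewrite [Z in measurable Z](_ : _ = path_event N i `&`
        \bigcap_(k in [set k | (k < N)%N]) [set w | s k < H k w]).
      apply: measurableI => //; apply: bigcap_measurableType => k _.
      rewrite -[Z in measurable Z]setTI; apply: (measurable_fun_ltr _ _ _) => //.
      apply/seteqP; split => w; rewrite -(in_setE E) EE.
      by move=> /andP[/[!inE] Bw /forallP h]; split=> // k /= kN; exact: (h (Ordinal kN)).
    move=> [Bw h]; apply/andP; split; first by rewrite inE.
    by apply/forallP => k; apply: h => /=.
  transitivity (\int[P]_w (\1_E w)%:E)%E.
    apply: eq_integral => w _; rewrite /mixed prod_indicator !indicE EE.
    by case: (w \in _) => /=; case: ifP; rewrite ?mul0r ?mulr0 ?mulr1.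
  rewrite integral_indic// setIT; etransitivity; first exact: PE.
  congr EFin; congr (_ * _).
  apply: eq_bigr => k _; rewrite ltn_ord; congr expR; ring.
pose o := Ordinal mN.
have split_prod (f : 'I_N -> R) : \prod_(k < N) f k = f o * \prod_(k < N | k != o) f k.
  by rewrite (bigD1 o).
have other k : k != o -> (k < m.+1)%N = (k < m)%N.
  by move=> ko; rewrite ltnS leq_eqVlt -(inj_eq val_inj) /= in ko *; rewrite (negPf ko).
pose F w : R := \1_(path_event N i) w * \prod_(k < N | k != o)
  (if (k < m)%N then expR (- (theta (i k) * H k w)) else if s k < H k w then 1 else 0).
pose c := - Q (i m) (i m).
have c0 : 0 < c by rewrite oppr_gt0 Q0// ai.
have F0 w : 0 <= F w.
  rewrite mulr_ge0// ?indicE// prodr_ge0// => k _.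
  by case: ifP => _; [exact: expR_ge0|case: ifP].
pose C := (i 0%N == x)%:R * \prod_(k < N) jump_matrix Q (i k) (i k.+1) *
   \prod_(k < N | k != o) (if (k < m)%N then - Q (i k) (i k) / (- Q (i k) (i k) + theta (i k))
                    else expR (- (- Q (i k) (i k) * s k))).
have C0 : 0 <= C.
  rewrite mulr_ge0 ?mulr_ge0 ?prodr_ge0// => k _; case: ifP => _; last exact: expR_ge0.
  by rewrite divr_ge0 ?addr_ge0// oppr_ge0 ltW// Q0// ai.
have tail u : 0 <= u -> (\int[P]_w (if u < H m w then F w else 0)%:E =
    (C * expR (- (c * u)))%:E)%E.
  move=> u0; pose s' k := if k == m then u else s k.
  have := IH s' _ (ltnW mN).
  rewrite [X in (_ * X)%:E]split_prod /= ltnn [s' m]/s' eqxx => IHm.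
  rewrite [RHS](_ : _ = ((i 0%N == x)%:R * \prod_(k < N) jump_matrix Q (i k) (i k.+1) *
     (expR (- (- Q (i m) (i m) * u)) * \prod_(k < N | k != o)
       (if (k < m)%N then - Q (i k) (i k) / (- Q (i k) (i k) + theta (i k))
        else expR (- (- Q (i k) (i k) * s' k)))))%:E); last first.
    rewrite /C -[LHS]/((_ * _ * _)%:E) -mulrA; congr EFin; congr (_ * _).
    rewrite mulrC; congr (_ * _); apply: eq_bigr => k ko.
    by rewrite /s' -(inj_eq val_inj) /= in ko *; rewrite (negPf ko).
  rewrite -IHm; last by move=> k; rewrite /s'; case: ifP.
  apply: eq_integral => w _; rewrite /mixed split_prod /= ltnn /s' eqxx mulrCA.
  congr EFin; rewrite [X in _ = _ * X](_ : _ = F w).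
    by case: ifP => _; rewrite ?mul1r ?mul0r.
  rewrite /F; congr (_ * _); apply: eq_bigr => k ko.
  by rewrite -(inj_eq val_inj) /= in ko *; rewrite (negPf ko).
have mF : measurable_fun setT F.
  apply: measurable_funM; first exact: measurable_indic.
  under eq_fun do rewrite big_mkcond.
  apply: measurable_prod => k _; case: (k != o) => //; case: (k < m)%N.
    exact: (measurableT_comp (measurable_exp_lin (theta (i k))) (mH k)).
  by apply: measurable_fun_ifT => //; apply: measurable_fun_ltr => //; exact: mH.
have FC : (\int[P]_w (F w)%:E = C%:E)%E.
  have := tail 0 (lexx _); rewrite mulr0 oppr0 expR0 mulr1 => <-.
  apply: eq_integral => w _; case: ifPn => // Hw.
  have [Bw|/negPf Bw] := boolP (w \in path_event N i); last by rewrite /F indicE Bw mul0r.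
  have [/(_ m mN) [_ h] _] := hold_on_path iN (set_mem Bw).
  by rewrite h in Hw.
have L := laplace_from_tail mF (mH m) F0 (fun w => hold_ge0 _ _) c0 (theta0 (i m)) C0 FC tail.
rewrite [X in (_ * X)%:E]split_prod /= ltnSn.
rewrite [RHS](_ : _ = (C * (c / (c + theta (i m))))%:E); last first.
  rewrite /C -[RHS]/((_ * _ * _)%:E) -[in RHS]mulrA; congr EFin; congr (_ * _).
  rewrite mulrC; congr (_ * _).
  by apply: eq_bigr => k /other ->.
rewrite -L; apply: eq_integral => w _; congr EFin.
rewrite /mixed split_prod /= ltnSn mulrCA mulrC; congr (_ * _).
by rewrite /F; congr (_ * _); apply: eq_bigr => k /other ->.
Qed.


Let K := discounted_kernel Q theta.

Let K0 i j : 0 <= K i j.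
Proof. by rewrite mulr_ge0// divr_ge0 ?addr_ge0 ?oppr_ge0. Qed.

(** A path with a step from a state to itself has probability 0, and the kernel
    vanishes on such a step as well. *)
Let path_integral N (i : nat -> nat) : (forall k, (k < N)%N -> (a < i k)%N) ->
  (\int[P]_w (\1_(path_event N i) w *
       \prod_(k < N) expR (- (theta (i k) * H k w)))%:E =
   ((i 0%N == x)%:R * \prod_(k < N) K (i k) (i k.+1))%:E)%E.
Proof.
move=> ai; have [iN|] := pselect (forall k, (k < N)%N -> i k != i k.+1).
  have M := @mixed_integral N i (fun=> 0) N iN ai (fun=> lexx 0) (leqnn N).
  transitivity (\int[P]_w (mixed N i (fun=> 0) N w)%:E)%E.
    apply: eq_integral => w _; congr EFin; congr (_ * _).
    by apply: eq_bigr => k _; rewrite ltn_ord.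
  rewrite M -mulrA -big_split; congr EFin; congr (_ * _).
  by apply: eq_bigr => k _; rewrite ltn_ord.
move=> /existsNP[k /not_implyP[kN /negP]]; rewrite negbK => /eqP ik.
have jk : jump_matrix Q (i k) (i k.+1) = 0.
  by rewrite /jump_matrix lt_eqF ?Q0 ?ai// -ik eqxx.
have P0 : P (path_event N i) = 0%E.
  by rewrite P_path_event (bigD1 (Ordinal kN)) //= jk mul0r mulr0.
rewrite (bigD1 (Ordinal kN)) //= [K _ _]/K /discounted_kernel jk !mul0r mulr0.
apply/eqP; rewrite eq_le; apply/andP; split; last first.
  apply: integral_ge0 => w _.
  by rewrite lee_fin mulr_ge0// ?prodr_ge0// => j _; exact: expR_ge0.
apply: (@le_trans _ _ (\int[P]_w (\1_(path_event N i) w)%:E)%E); last first.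
  by rewrite integral_indic// setIT le_eqVlt; apply/orP; left; apply/eqP; exact: P0.
apply: ge0_le_integral => //.
- by move=> w _; rewrite lee_fin mulr_ge0// ?prodr_ge0// => j _; exact: expR_ge0.
- apply/measurable_EFinP; apply: measurable_funM; first exact: measurable_indic.
  apply: measurable_prod => j _.
  exact: (measurableT_comp (measurable_exp_lin (theta (i j))) (mH j)).
- by apply/measurable_EFinP; exact: measurable_indic.
move=> w _; rewrite lee_fin ler_piMr// prodr_ile1// => j _.
by rewrite expR_ge0 -expR0 ler_expR oppr_le0 mulr_ge0// hold_ge0.
Qed.

Let hits N : set T := [set w | hits_at (X ^~ w) a N].
Let W N w : R := \prod_(k < N) expR (- (theta (Y k w) * H k w)).

Let m_hits N : measurable (hits N).
Proof. exact: measurable_hits_at. Qed.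

Let mW N : measurable_fun setT (W N).
Proof.
apply: measurable_prod => k _; apply: (measurableT_comp (@measurable_expR R)).
apply: measurableT_comp => //; apply: measurable_funM; last exact: mH.
by apply: (measurableT_comp (f := theta)) => //; exact: mY.
Qed.

Let W0 N w : 0 <= W N w.
Proof. by apply: prodr_ge0 => k _; exact: expR_ge0. Qed.

Let integral_partition (A : set T) N n : measurable A ->
  (\int[P]_w (\1_A w * W N w)%:E =
   \sum_(0 <= j <oo) \int[P]_w (\1_(A `&` [set w | Y n w = j]) w * W N w)%:E)%E.
Proof.
move=> mA; have mYj j : measurable [set w | Y n w = j] by exact: measurable_chain_state.
rewrite -integral_nneseries//; first last.
- by move=> j w _; rewrite lee_fin mulr_ge0.
- move=> j; apply/measurable_EFinP; apply: measurable_funM => //.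
  by apply: measurable_indic; exact: measurableI.
apply: eq_integral => w _; rewrite (@nneseriesD1 _ _ (Y n w))//; last first.
  by move=> j _; rewrite lee_fin mulr_ge0.
rewrite eseries0 ?adde0; last first.
  move=> j _ /= jY; rewrite indicE memNset ?mul0r// => -[_ /= E].
  by rewrite E eqxx in jY.
congr EFin; congr (_ * _); rewrite !indicE; congr (_%:R).
by apply: congr1; apply/idP/idP; rewrite !inE => // -[].
Qed.

(** Summing over the paths that extend a given one, by induction on the number n
    of steps that remain. *)
Let prefix_integral n m (i : nat -> nat) : (forall k, (k < m)%N -> (a < i k)%N) ->
  (\int[P]_w (\1_(path_event m i `&` hits (m + n)) w * W (m + n) w)%:E =
   ((i 0%N == x)%:R * \prod_(k < m) K (i k) (i k.+1))%:E *
     passage_weight K a n (i m))%E.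
Proof.
elim: n m i => [|n IH] m i ai.
  rewrite addn0 /=; case: ifP => ima; last first.
    rewrite mule0 integral0_eq// => w _; rewrite indicE memNset ?mul0r//.
    by move=> [Bw [_]]; rewrite -/(Y m w) (Bw m (leqnn m)) ima.
  rewrite mule1 -(path_integral ai); apply: eq_integral => w _; congr EFin.
  rewrite !indicE; have [wB|wB] := boolP (w \in path_event m i).
    have Bw := set_mem wB; rewrite mem_set; last first.
      split=> //; split; last by rewrite -/(Y m w) (Bw m (leqnn m)).
      by move=> k km; rewrite -/(Y k w) (Bw k (ltnW km)) ai.
    congr (_ * _); apply: eq_bigr => k _.
    by rewrite (Bw k (ltnW (ltn_ord k))).
  by rewrite memNset ?mul0r// => -[/mem_set]; rewrite (negPf wB).
have [ima|aim] := leqP (i m) a.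
  rewrite /= ima mule0 integral0_eq// => w _; rewrite indicE memNset ?mul0r//.
  move=> [Bw [/(_ m)]]; rewrite -/(Y m w) (Bw m (leqnn m)) [(a < _)%N]ltnNge ima.
  by rewrite -addSnnS ltnS leq_addr => /(_ erefl).
rewrite (@integral_partition _ _ m.+1)//; last exact: measurableI.
rewrite /= leqNgt aim /= -nneseriesZl; last first.
  by move=> j _; rewrite mule_ge0 ?passage_weight_ge0 ?lee_fin.
apply: eq_eseriesr => j _.
pose i' k := if k == m.+1 then j else i k.
have i'i k : (k <= m)%N -> i' k = i k.
  by move=> km; rewrite /i' ltn_eqF.
have ai' k : (k < m.+1)%N -> (a < i' k)%N.
  rewrite ltnS => km; rewrite i'i//; move: km; rewrite leq_eqVlt => /orP[/eqP -> //|].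
  exact: ai.
have := IH m.+1 i' ai'; rewrite big_ord_recr /= [i' m.+1]/i' eqxx !i'i//.
rewrite (eq_bigr (fun k : 'I_m => K (i k) (i k.+1))); last first.
  by move=> k _; rewrite !i'i//; exact: ltnW.
rewrite mulrA EFinM -muleA => <-; rewrite addSnnS.
apply: eq_integral => w _; congr EFin; congr (_ * _); rewrite !indicE; congr (_%:R).
apply: congr1; apply/idP/idP; rewrite !inE.
  move=> [[Bw hw] Yj]; split=> // k; rewrite leq_eqVlt => /orP[/eqP ->|].
    by rewrite /i' eqxx.
  by rewrite ltnS => km; rewrite i'i// Bw.
move=> [Bw hw]; split; last by rewrite /= (Bw m.+1)// /i' eqxx.
by split=> // k km; rewrite (Bw k (leqW km)) i'i.
Qed.

Let hits_unique w M N : hits M w -> hits N w -> M = N.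
Proof.
move=> [loM hiM] [loN hiN]; case: (ltngtP M N) => // [/loN|/loM] h.
  by have := leq_trans h hiM; rewrite ltnn.
by have := leq_trans h hiN; rewrite ltnn.
Qed.

Let hits_integral N :
  (\int[P]_w (\1_(hits N) w * W N w)%:E)%E = passage_weight K a N x.
Proof.
rewrite (@integral_partition _ _ 0%N)//.
rewrite (@nneseriesD1 _ _ x)//; last first.
  by move=> j _; apply: integral_ge0 => w _; rewrite lee_fin mulr_ge0.
have E j : (\int[P]_w (\1_(hits N `&` [set w | Y 0%N w = j]) w * W N w)%:E =
    (j == x)%:R%:E * passage_weight K a N j)%E.
  have := @prefix_integral N 0%N (fun=> j); rewrite add0n big_ord0 mulr1 => <-//.
  apply: eq_integral => w _; congr EFin; congr (_ * _); rewrite !indicE; congr (_%:R).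
  apply: congr1; apply/idP/idP; rewrite !inE => -[h1 h2]; split=> //.
    by move=> k; rewrite leqn0 => /eqP ->.
  exact: h1.
rewrite E eqxx mul1e eseries0 ?adde0// => j _ /= /negPf jx.
by rewrite E jx mul0e.
Qed.

(** On the event that {0, ..., a} is entered at the N-th state, the integrand is
    the product of the exponential weights of the first N holding times. *)
Lemma passage_transformE (q qbar : R) : (forall i, theta i = q + qbar * i%:R) ->
  passage_transform P X a q qbar = passage_value (discounted_kernel Q theta) a x.
Proof.
move=> thetaE; rewrite /passage_value.
under [RHS]eq_eseriesr do rewrite -hits_integral.
rewrite -integral_nneseries//; first last.
- by move=> N w _; rewrite lee_fin mulr_ge0.
- by move=> N; apply/measurable_EFinP; apply: measurable_funM.
rewrite /passage_transform [LHS]integral_mkcond; apply: eq_integral => w _.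
rewrite patchE; case: ifPn => [|wD]; last first.
  rewrite eseries0// => N _ _; rewrite indicE memNset ?mul0r// => hN.
  move/negP: wD; apply; rewrite inE /= (hits_at_passage (hX w) hN).
  exact: ltry.
rewrite inE /= => /(passage_hits (hX w))[N hN].
rewrite (@nneseriesD1 _ _ N)//; last by move=> k _; rewrite lee_fin mulr_ge0.
rewrite eseries0 ?adde0; last first.
  move=> k _ /= kN; rewrite indicE memNset ?mul0r// => /(hits_unique hN) NK.
  by rewrite NK eqxx in kN.
rewrite indicE mem_set//= mul1r (hits_at_area (hX w) hN) (hits_at_passage (hX w) hN).
rewrite -!EFinM -EFinN -EFinB /= /W -expR_sum; congr (expR _)%:E.
rewrite !mulr_sumr -sumrN -sumrB; apply: eq_bigr => k _.
by rewrite thetaE /Y /H; ring.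
Qed.

End PassageTransform.

(** * Calculus on an open interval *)

Section OpenIntervalCalculus.
Variable R : realType.
Local Notation leb := (@lebesgue_measure R).
Implicit Types (a b u v : R) (f F : R -> R).

Lemma continuous_oo_within a b f (i : interval R) :
  {in `]a, b[, continuous f} -> (forall z, z \in i -> a < z < b) ->
  {within [set` i], continuous f}.
Proof.
move=> cf iab; apply: continuous_in_subspaceT => z /set_mem /= /iab zab.
by apply: cf; rewrite in_itv.
Qed.

Lemma continuous_oo_measurable a b f (i : interval R) :
  {in `]a, b[, continuous f} -> (forall z, z \in i -> a < z < b) ->
  measurable_fun [set` i] f.
Proof.
move=> cf iab; apply: subspace_continuous_measurable_fun => //.
exact: continuous_oo_within cf iab.
Qed.

Lemma continuous_oo_integrable a b f u v :
  {in `]a, b[, continuous f} -> a < u -> v < b ->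
  leb.-integrable `[u, v] (EFin \o f).
Proof.
move=> cf au vb; apply: continuous_compact_integrable.
  exact: segment_compact.
apply: continuous_oo_within cf _ => z; rewrite in_itv /=; lra.
Qed.

Lemma FTC_oo a b F f (u v : R) :
  {in `]a, b[, continuous f} -> {in `]a, b[, forall z : R, is_derive z 1 F (f z)} ->
  a < u -> u <= v -> v < b ->
  (\int[leb]_(z in `[u, v]) (f z)%:E = (F v - F u)%:E)%E.
Proof.
move=> cf dF au; rewrite le_eqVlt => /orP[/eqP ->|uv] vb.
  by rewrite set_itv1 integral_set1 subrr.
have cF z : a < z < b -> F x @[x --> z] --> F z.
  move=> zab; have /dF [dz _] : z \in `]a, b[ by rewrite in_itv.
  exact/differentiable_continuous/derivable1_diffP.
rewrite (@continuous_FTC2 _ f F u v)//.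
- by apply: continuous_oo_within cf _ => z; rewrite in_itv /=; lra.
- split.
  + move=> z; rewrite in_itv /= => zuv.
    by have /dF [] : z \in `]a, b[ by rewrite in_itv /=; lra.
  + by apply: cvg_at_right_filter; apply: cF; lra.
  + by apply: cvg_at_left_filter; apply: cF; lra.
- move=> z; rewrite in_itv /= => zuv; rewrite derive1E.
  by have /dF [] : z \in `]a, b[ by rewrite in_itv /=; lra.
Qed.

(** These segments exhaust ]a, b[; the denominators start at 3 so that they are
    not empty. *)
Definition inner_left a b n : R := a + (b - a) / n.+3%:R.
Definition inner_right a b n : R := b - (b - a) / n.+3%:R.

Lemma inner_bounds a b n : a < b ->
  [/\ a < inner_left a b n, inner_left a b n <= inner_right a b n
    & inner_right a b n < b].
Proof.
move=> ab; have n0 : 0 < n.+3%:R :> R by [].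
have h : 0 < (b - a) / n.+3%:R by rewrite divr_gt0// subr_gt0.
have h2 : 2 * ((b - a) / n.+3%:R) <= b - a.
  rewrite mulrCA ler_piMr ?subr_ge0 ?(ltW ab)//.
  by rewrite ler_pdivrMr// mul1r ler_nat.
rewrite /inner_left /inner_right; move: h h2.
by move: ((b - a) / n.+3%:R) => h h0 h2; split; lra.
Qed.

Lemma inner_mono a b m n : a < b -> (m <= n)%N ->
  `[inner_left a b m, inner_right a b m] `<=`
  `[inner_left a b n, inner_right a b n].
Proof.
move=> ab mn z /=; rewrite !in_itv /= /inner_left /inner_right.
have : (b - a) / n.+3%:R <= (b - a) / m.+3%:R.
  by rewrite ler_wpM2l ?subr_ge0 ?(ltW ab)// lef_pV2 ?posrE// ler_nat !ltnS.
move: ((b - a) / n.+3%:R) ((b - a) / m.+3%:R) => e1 e2; lra.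
Qed.

Lemma inner_cvg a b : (b - a) / n.+3%:R @[n --> \oo] --> (0 : R).
Proof.
rewrite -(mulr0 (b - a)); apply: cvgMl_tmp.
have := @cvg_harmonic R; rewrite -(cvg_shiftn 2); apply: cvg_trans.
by apply: near_eq_cvg; apply: nearW => n /=; rewrite addn2.
Qed.

Lemma inner_left_cvg a b : inner_left a b n @[n --> \oo] --> a.
Proof.
rewrite -[X in _ --> X]addr0; apply: cvgD; first exact: cvg_cst.
exact: inner_cvg.
Qed.

Lemma inner_right_cvg a b : inner_right a b n @[n --> \oo] --> b.
Proof.
rewrite -[X in _ --> X]subr0; apply: cvgB; first exact: cvg_cst.
exact: inner_cvg.
Qed.

Lemma inner_near a b z : a < z < b ->
  \forall n \near \oo, z \in `[inner_left a b n, inner_right a b n].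
Proof.
move=> /andP[az zb].
have h1 : \forall n \near \oo, inner_left a b n < z.
  exact: (cvgr_lt _ (@inner_left_cvg a b)).
have h2 : \forall n \near \oo, z < inner_right a b n.
  exact: (cvgr_gt _ (@inner_right_cvg a b)).
near=> n; rewrite in_itv /=; apply/andP; split; apply: ltW.
  by near: n.
by near: n.
Unshelve. all: by end_near. Qed.

Lemma inner_cover a b : a < b ->
  \bigcup_n `[inner_left a b n, inner_right a b n]%classic = `]a, b[%classic.
Proof.
move=> ab; apply/seteqP; split => z /=.
  move=> [n _] /=; rewrite !in_itv /=; have [? ? ?] := inner_bounds n ab; lra.
rewrite in_itv /= => /inner_near[n _ /(_ n (leqnn n)) h].
by exists n.
Qed.

Lemma ge0_integral_oo_le a b f (M : \bar R) : a < b ->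
  measurable_fun `]a, b[ f -> (forall z, a < z < b -> 0 <= f z) ->
  (forall u v, a < u -> u <= v -> v < b ->
     (\int[leb]_(z in `[u, v]) (f z)%:E <= M)%E) ->
  (\int[leb]_(z in `]a, b[) (f z)%:E <= M)%E.
Proof.
move=> ab mf f0 fM; rewrite -inner_cover//.
have sub n : `[inner_left a b n, inner_right a b n] `<=` `]a, b[.
  by move=> z /=; rewrite !in_itv /=; have [? ? ?] := inner_bounds n ab; lra.
have c : (\int[leb]_(z in `[inner_left a b n, inner_right a b n]) (f z)%:E)%E @[n --> \oo]
   --> (\int[leb]_(z in \bigcup_n
          `[inner_left a b n, inner_right a b n]%classic) (f z)%:E)%E.
  apply: ge0_nondecreasing_set_cvg_integral => //.
  - by move=> m n mn; apply/subsetPset; exact: inner_mono.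
  - move=> n; apply/measurable_EFinP; exact: measurable_funS mf.
  - by move=> n z /sub /=; rewrite in_itv /= => zab; rewrite lee_fin; exact: f0.
rewrite -(cvg_lim _ c)//; apply: lime_le.
  by apply/cvg_ex; eexists; exact: c.
by apply: nearW => n; apply: fM; have [] := inner_bounds n ab.
Qed.

Lemma FTC_improper a b F f : a < b ->
  {in `]a, b[, continuous f} -> {in `]a, b[, forall z : R, is_derive z 1 F (f z)} ->
  leb.-integrable `]a, b[ (EFin \o f) ->
  F @ a^'+ --> (0 : R) -> F @ b^'- --> (0 : R) ->
  (\int[leb]_(z in `]a, b[) (f z)%:E = 0)%E.
Proof.
move=> ab cf dF fi Fa Fb.
pose I n := `[inner_left a b n, inner_right a b n]%classic : set R.
have sub n : I n `<=` `]a, b[.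
  by move=> z; rewrite /I /= !in_itv /=; have [? ? ?] := inner_bounds n ab; lra.
have mf : measurable_fun `]a, b[ (EFin \o f) by exact: (measurable_int leb).
have [_ _ c] : [/\ leb.-integrable `]a, b[ (EFin \o f),
   [sequence \int[leb]_(x in `]a, b[)
      `|((EFin \o f) \_ (I n)) x - (EFin \o f) x|]_n @ \oo --> 0 &
   [sequence \int[leb]_(x in `]a, b[) ((EFin \o f) \_ (I n)) x]_n @ \oo
     --> \int[leb]_(x in `]a, b[) (EFin \o f) x]%E.
  apply: (@dominated_convergence _ _ _ leb `]a, b[ _ (fun n => (EFin \o f) \_ (I n))
     (EFin \o f) (abse \o (EFin \o f))) => //.
  - move=> n; apply/measurable_restrict => //; first exact: measurable_itv.
    by apply: measurable_funS mf => // z [].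
  - apply: aeW => z /=; rewrite in_itv /= => /inner_near zn.
    apply: cvg_near_cst; apply: filterS zn => n zn.
    by rewrite patchE ifT// inE.
  - exact: integrable_abse.
  - apply: aeW => z n _ /=; rewrite patchE; case: ifP => // _.
    by rewrite abse0.
have E : [sequence (\int[leb]_(x in `]a, b[) ((EFin \o f) \_ (I n)) x)%E]_n =
    (fun n => (F (inner_right a b n) - F (inner_left a b n))%:E).
  apply/funext => n /=; rewrite -integral_mkcondr setIidr; last exact: sub.
  by have [h1 h2 h3] := inner_bounds n ab; rewrite /I (FTC_oo cf dF).
rewrite E in c.
rewrite -(cvg_lim _ c)//; apply: cvg_lim => //.
apply: cvg_EFin; first exact: nearW.
rewrite -(subr0 0); apply: cvgB.
- move/cvg_at_leftP : Fb; apply; split => [n|]; last exact: inner_right_cvg.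
  by have [] := inner_bounds n ab.
- move/cvg_at_rightP : Fa; apply; split => [n|]; last exact: inner_left_cvg.
  by have [] := inner_bounds n ab.
Qed.

End OpenIntervalCalculus.

(** * The weight E / D *)

Section Weight.
Variable R : realType.
Local Notation leb := (@lebesgue_measure R).
Implicit Types u v w z l : R.
Variables (N D : R -> R) (b c : R).
Hypothesis c0 : 0 <= c.
Hypothesis cb : c < b.
Hypothesis cN : {in `]0, b[, continuous N}.
Hypothesis cD : {in `]0, b[, continuous D}.
Hypothesis D0 : forall v, 0 < v < b -> 0 < D v.
Hypothesis gi : forall v, c < v < b ->
  leb.-integrable `[c, v] (EFin \o (fun w => N w / D w)).
Ltac lra_c := have ? := c0; have ? := cb; lra.

Let g w := N w / D w.
Let I v := oriented_integral g c v.

(** v |-> v^n E(v) has the derivative n v^(n-1) E - v^n E N / D. *)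
Definition integrating_factor (v : R) : R := expR (- I v).
Local Notation E := integrating_factor.

Let cg : {in `]0, b[, continuous g}.
Proof.
move=> v vb; apply: cvgM; first exact: cN.
apply: cvgV; last exact: cD.
by rewrite gt_eqF// D0//; move: vb; rewrite in_itv.
Qed.

(** The integral from c, which may lie on either side of v, is a difference of
    integrals from a point s to the left of both. *)
Let anchor v : 0 < v < b -> exists s u : R, [/\ s <= c, s < v < u, c < u,
    u < b & leb.-integrable `[s, u] (EFin \o g)].
Proof.
move=> vb; pose m := Num.max c v; pose u := (m + b) / 2.
have [cm vm mb] : [/\ c <= m, v <= m & m < b].
  by rewrite /m !le_max !lexx gt_max cb orbT; split=> //; lra_c.
have [um ub] : m < u /\ u < b by rewrite /u; lra_c.
have cu : c < u by lra_c.
(* Integrability up to 0 is only assumed from c: the interval starts at c if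
   c = 0, and at a positive point otherwise. *)
have [c00|cN0] := eqVneq c 0.
  exists c, u; split=> //; [|by apply: gi; rewrite cu ub].
  rewrite c00; lra_c.
have c1 : 0 < c by rewrite lt_neqAle eq_sym cN0.
pose s := Num.min c v / 2.
have s0 : 0 < s by rewrite divr_gt0// lt_min c1; lra_c.
have [sc sv] : s <= c /\ s < v.
  have : Num.min c v <= c by rewrite ge_min lexx.
  have : Num.min c v <= v by rewrite ge_min lexx orbT.
  by rewrite /s in s0 *; lra_c.
exists s, u; split=> //; first by lra_c.
exact: continuous_oo_integrable cg s0 ub.
Qed.

Let I_anchored s u z : s <= c -> c < u -> leb.-integrable `[s, u] (EFin \o g) ->
  s < z < u -> I z = \int[leb]_(w in `[s, z]) g w - \int[leb]_(w in `[s, c]) g w.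
Proof.
move=> sc cu gsu /andP[sz zu]; rewrite /I /oriented_integral.
have sub x y : s <= x -> y <= u -> leb.-integrable `[x, y] (EFin \o g).
  move=> sx yu; apply: integrableS gsu => //.
  by move=> w /=; rewrite !in_itv /=; lra_c.
have sub' x y : s <= x -> y <= u -> leb.-integrable `]x, y] (EFin \o g).
  move=> sx yu; apply: integrableS (sub x y sx yu) => //.
  by move=> w /=; rewrite !in_itv /=; lra_c.
case: (leP c z) => cz.
  rewrite -Rintegral_itv_obnd_cbnd; last by apply: sub'; lra_c.
  by rewrite -(@Rintegral_itvB _ g (BLeft s) (BRight z) c) ?bnd_simp//; apply: sub; lra_c.
rewrite -Rintegral_itv_obnd_cbnd; last by apply: sub'; lra_c.
rewrite -(@Rintegral_itvB _ g (BLeft s) (BRight c) z) ?bnd_simp ?opprB//; try lra_c.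
by apply: sub; lra_c.
Qed.

Let dI v : 0 < v < b -> is_derive v 1 I (g v).
Proof.
move=> vb; have [s [u [sc svu cu ub gsu]]] := anchor vb.
pose G z := \int[leb]_(w in `[s, z]) g w.
have [dG G'] : derivable G v 1 /\ derive1 G v = g v.
  apply: (@continuous_FTC1_closed _ g s v u) => //; try lra_c.
  by apply: cg; rewrite in_itv.
have dGv : is_derive v 1 G (g v) by apply: (DeriveDef dG); rewrite -derive1E.
apply: (@near_eq_is_derive _ _ _ (fun z => G z - G c)); last first.
  by apply: is_derive_eq; rewrite subr0.
near=> z; apply/esym; apply: (@I_anchored s u) => //; apply/andP; split.
  by near: z; apply: lt_nbhsr; lra_c.
by near: z; apply: lt_nbhsl; lra_c.
Unshelve. all: by end_near. Qed.

Lemma integrating_factor_derive v : 0 < v < b -> is_derive v 1 E (- (E v * g v)).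
Proof.
move=> /dI dIv; rewrite /integrating_factor.
apply: is_derive_eq; rewrite /GRing.scale /=; ring.
Qed.

Lemma integrating_factor_continuous : {in `]0, b[, continuous E}.
Proof.
move=> v; rewrite in_itv /= => /integrating_factor_derive[dv _].
exact/differentiable_continuous/derivable1_diffP.
Qed.

Definition weight v : R := E v / D v.

Lemma weight_gt0 v : 0 < v < b -> 0 < weight v.
Proof. by move=> vb; rewrite divr_gt0 ?expR_gt0 ?D0. Qed.

Lemma weight_continuous : {in `]0, b[, continuous weight}.
Proof.
move=> v vb; apply: cvgM; first exact: integrating_factor_continuous.
apply: cvgV; last exact: cD.
by rewrite gt_eqF// D0//; move: vb; rewrite in_itv.
Qed.

Hypothesis Nneg : forall v, 0 < v < c -> N v <= 0.
Hypothesis Npos : forall v, c < v < b -> 0 <= N v.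

(** The lower limit c of the exponent is the point where N changes sign, so that
    the oriented integral of N / D from c is nonnegative on both sides of c. *)
Lemma integrating_factor_le1 v : 0 < v < b -> E v <= 1.
Proof.
move=> vb; rewrite /integrating_factor -expR0 ler_expR oppr_le0.
have [s [u [sc svu cu ub gsu]]] := anchor vb.
have closed x y : s <= x -> y <= u ->
    \int[leb]_(w in `[x, y]) g w = \int[leb]_(w in `]x, y[) g w.
  move=> sx yu; rewrite /Rintegral integral_itv_bndoo//.
  apply: (measurable_int leb); apply: integrableS gsu => //.
  by move=> w /=; rewrite !in_itv /=; lra_c.
rewrite /I /oriented_integral; case: (leP c v) => cv; 
  [rewrite (closed c v)|rewrite (closed v c)]; try lra_c.
  have g0 w : c < w < v -> 0 <= g w.
    move=> /andP[cw wv]; have wb := lt_trans wv (andP vb).2.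
    apply: divr_ge0; first by apply: Npos; rewrite cw wb.
    by apply/ltW/D0; rewrite (le_lt_trans c0 cw) wb.
  by apply: Rintegral_ge0 => w /=; rewrite in_itv /=; exact: g0.
have g0 w : v < w < c -> 0 <= - g w.
  move=> /andP[vw wc]; have w0 := lt_trans (andP vb).1 vw.
  rewrite -mulNr; apply: divr_ge0; last by apply/ltW/D0; rewrite w0 (lt_trans wc cb).
  by rewrite oppr_ge0 Nneg// w0 wc.
have int0 : leb.-integrable `]v, c[ (EFin \o g).
  by apply: integrableS gsu => // w /=; rewrite !in_itv /=; lra_c.
rewrite oppr_ge0; apply: (@le_trans _ _ (\int[leb]_(w in `]v, c[) 0)).
  apply: le_Rintegral => //; first exact: integrable0.
  by move=> w /=; rewrite in_itv /= => /g0; rewrite oppr_ge0.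
by rewrite Rintegral_cst// mul0r.
Qed.

Variables (e b0 k : R).
Hypothesis e0 : 0 < e.
Hypothesis cb0 : c <= b0.
Hypothesis b0b : b0 < b.
Hypothesis Ne : forall v, b0 < v < b -> e <= N v.
Hypothesis k0 : 0 < k.
Hypothesis Dk : forall v, 0 < v < b -> D v <= k * (b - v).
Ltac lra_end := have ? := c0; have ? := cb; have ? := cb0; have ? := b0b;
  have ? := e0; lra.

(** Since D vanishes at most linearly at b, the exponent diverges there at least
    like a multiple of ln (b - v). *)
Lemma integrating_factor_cvg_right : E @ b^'- --> (0 : R).
Proof.
pose kap := e / k; have kap0 : 0 < kap by rewrite divr_gt0.
pose h v := I v + kap * ln (b - v).
have dh v : b0 < v < b -> is_derive v 1 h (g v - kap / (b - v)).
  move=> vb; have dIv : is_derive v 1 I (g v) by apply: dI; lra_end.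
  have bv : 0 < b - v by lra_end.
  have dln := @is_derive1_ln R (b - v) bv.
  have dlin : is_derive v 1 (fun v => b - v) (-1).
    by apply: is_derive_eq; rewrite add0r mul1r.
  have dcomp : is_derive v 1 (fun v => ln (b - v)) (- (b - v)^-1).
    have dc := @is_derive1_comp R (@ln R) (fun v => b - v) v _ _ dln dlin.
    by apply: (is_derive_eq dc); rewrite mulrN1.
  apply: is_derive_eq; rewrite /GRing.scale /=; ring.
have hmono : {in `]b0, b[ &, {homo h : x y / x <= y}}.
  apply: ger0_derive1_le_oo.
  - by move=> v; rewrite in_itv /= => /dh [].
  - move=> v; rewrite in_itv /= => vb; rewrite derive1E; have [_ ->] := dh v vb.
    rewrite subr_ge0 /g /kap; have Dv : 0 < D v by apply: D0; lra_end.
    have bv : 0 < b - v by lra_end.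
    rewrite ler_pdivrMr// mulrAC ler_pdivlMr//.
    have h1 : e <= N v by exact: Ne.
    have h2 : D v <= k * (b - v) by apply: Dk; lra_end.
    have h3 : e / k * D v <= e * (b - v).
      by rewrite mulrAC ler_pdivrMr// -mulrA ler_pM2l// mulrC.
    apply: le_trans h3 _; rewrite ler_pM2r//.
  - move=> v /set_mem; rewrite /= in_itv /= => /dh [dv _].
    exact/differentiable_continuous/derivable1_diffP.
pose m := (b0 + b) / 2.
have mb : b0 < m < b by rewrite /m; lra_end.
apply/cvgr0Pnorm_lt => eps eps0.
(* h m <= h v gives - I v <= kap ln (b - v) - h m, which is below ln eps as soon
   as b - v < del. *)
pose del := expR ((ln eps + h m) / kap).
have del0 : 0 < del by exact: expR_gt0.
near=> v.
have vb : v < b by near: v; exact: nbhs_left_lt.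
have mv : m < v by near: v; apply: nbhs_left_gt; lra_end.
have vd : b - del < v by near: v; apply: nbhs_left_gt; lra_end.
rewrite ger0_norm ?expR_ge0// /integrating_factor.
rewrite -[ltRHS](@lnK _ eps) ?posrE// ltr_expR.
have mI : m \in `]b0, b[ by rewrite in_itv.
have vI : v \in `]b0, b[.
  by rewrite in_itv /= vb andbT (lt_trans (andP mb).1 mv).
have hmv : h m <= h v := hmono _ _ mI vI (ltW mv).
have : kap * ln (b - v) < ln eps + h m.
  rewrite mulrC -ltr_pdivlMr// -ltr_expR lnK ?posrE; last lra_end.
  by rewrite -/del; lra_end.
by move: hmv; rewrite {2}/h; lra_end.
Unshelve. all: by end_near. Qed.

Hypothesis Dlow : forall v, v < b ->
  exists2 l : R, 0 < l & forall z, 0 < z <= v -> l <= D z.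

(** Near b the weight E / D is at most E N / (e D) = - E' / e. *)
Lemma weight_integral_finite : (\int[leb]_(v in `]0%R, b[) (weight v)%:E < +oo)%E.
Proof.
have b00 : 0 <= b0 by lra_end.
pose m := (b0 + b) / 2.
have mb : b0 < m < b by rewrite /m; lra_end.
have [|l l0 lD] := Dlow (v := m); first lra_end.
have mw (i : interval R) : (forall z, z \in i -> 0 < z < b) ->
    measurable_fun [set` i] (EFin \o weight).
  move=> ib; apply/measurable_EFinP.
  exact: continuous_oo_measurable weight_continuous ib.
have U : `]0, b[%classic = `]0, m] `|` `]m, b[ :> set R.
  by rewrite -itv_bndbnd_setU// bnd_simp; lra_end.
rewrite U ge0_integral_setU//=; first last.
- by apply/disj_set2P; rewrite -subset0 => s /= []; rewrite !in_itv /=; lra_end.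
- by move=> v [] /=; rewrite in_itv /= => vb; rewrite lee_fin ltW// weight_gt0//; lra_end.
- by rewrite -U; apply: mw => z; rewrite in_itv.
rewrite lte_add_pinfty//.
  apply: (@le_lt_trans _ _ (\int[leb]_(v in `]0%R, m]) (l^-1)%:E)%E).
    apply: ge0_le_integral => //.
    - by move=> v /=; rewrite in_itv /= => vm; rewrite lee_fin ltW// weight_gt0; lra_end.
    - by apply: mw => z; rewrite in_itv /=; lra_end.
    - move=> v /=; rewrite in_itv /= => vm; rewrite lee_fin /weight.
      rewrite ler_pdivrMr; last by apply: D0; lra_end.
      rewrite mulrC ler_pdivlMr//.
      have h1 : E v <= 1 by apply: integrating_factor_le1; lra_end.
      have h2 : l <= D v by exact: lD.
      by apply: le_trans h2; rewrite ler_piMl// ltW.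
  by rewrite integral_cst//= lebesgue_measure_itv /= lte_fin; case: ifP => _;
    rewrite -?EFinB -?EFinM ?mule0 ltry.
apply: (@le_lt_trans _ _ (e^-1)%:E); last exact: ltry.
apply: ge0_integral_oo_le; first lra_end.
- by apply/measurable_EFinP; apply: mw => z; rewrite in_itv /=; lra_end.
- by move=> z zb; rewrite ltW// weight_gt0//; lra_end.
move=> u v mu uv vb.
apply: (@le_trans _ _ (\int[leb]_(z in `[u, v]) (e^-1 * (E z * g z))%:E)%E).
  apply: ge0_le_integral => //.
  - by move=> z /=; rewrite in_itv /= => zb; rewrite lee_fin ltW// weight_gt0//; lra_end.
  - by apply: mw => z; rewrite in_itv /=; lra_end.
  - apply/measurable_EFinP; apply: (continuous_oo_measurable (a := 0) (b := b)).
      move=> z zb; apply: cvgMl_tmp; apply: cvgM; last exact: cg.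
      exact: integrating_factor_continuous.
    by move=> z; rewrite in_itv /=; lra_end.
  - move=> z /=; rewrite in_itv /= => zb; rewrite lee_fin /weight /g.
    have Dz : 0 < D z by apply: D0; lra_end.
    rewrite !mulrA ler_pM2r ?invr_gt0// mulrAC ler_peMl ?expR_ge0//.
    by rewrite mulrC ler_pdivlMr// mul1r; apply: Ne; lra_end.
have cF : {in `]0, b[, continuous (fun z => e^-1 * (E z * g z))}.
  move=> z zb; apply: cvgMl_tmp; apply: cvgM; last exact: cg.
  exact: integrating_factor_continuous.
have dF : {in `]0, b[, forall z : R,
    is_derive z 1 (fun z => - (e^-1 * E z)) (e^-1 * (E z * g z))}.
  move=> z; rewrite in_itv /= => zb; have dEz := integrating_factor_derive zb.
  by apply: is_derive_eq; rewrite /GRing.scale /=; ring.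
have u0 : 0 < u by lra_end.
rewrite (FTC_oo cF dF u0 uv vb).
rewrite lee_fin -opprD opprB -mulrBr ler_piMr ?invr_ge0 ?(ltW e0)//.
have : 0 < E v by exact: expR_gt0.
have : E u <= 1 by apply: integrating_factor_le1; lra_end.
by move: (E u) (E v) => x y ? ?; lra.
Qed.


Hypothesis b1 : b <= 1.

Lemma weight_moment_integrable n :
  leb.-integrable `]0, b[ (EFin \o (fun v => weight v * v ^+ n)).
Proof.
have mw : measurable_fun `]0, b[ (EFin \o weight).
  apply/measurable_EFinP; apply: continuous_oo_measurable weight_continuous _ => z.
  by rewrite in_itv.
apply: (@le_integrable _ _ _ leb _ _ _ (EFin \o weight)) => //.
- apply/measurable_EFinP; apply: measurable_funM; first exact/measurable_EFinP.
  exact: measurable_funX.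
- move=> v /=; rewrite in_itv /= => vb; have w0 := weight_gt0 vb; have ? := b1.
  rewrite lee_fin normrM ler_piMr// normrX exprn_ile1// ger0_norm; lra_end.
- apply/integrableP; split=> //.
  suff -> : (\int[leb]_(v in `]0%R, b[) `|(EFin \o weight) v| =
      \int[leb]_(v in `]0%R, b[) (weight v)%:E)%E by exact: weight_integral_finite.
  apply: eq_integral => v /set_mem; rewrite /= in_itv /= => /weight_gt0 w0.
  by rewrite ger0_norm// ltW.
Qed.

Variable C : R.
Hypothesis NC : forall v, 0 < v < b -> `|v * N v| <= C.

(** The boundary terms of v^n E vanish for n > 0: at 0 because E <= 1, and at b
    because E does. *)
Lemma weight_balance n :
  leb.-integrable `]0, b[
    (EFin \o (fun v => weight v * (n.+1%:R * v ^+ n * D v - v ^+ n.+1 * N v))) /\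
  (\int[leb]_(v in `]0%R, b[)
     (weight v * (n.+1%:R * v ^+ n * D v - v ^+ n.+1 * N v))%:E = 0)%E.
Proof.
pose f v := weight v * (n.+1%:R * v ^+ n * D v - v ^+ n.+1 * N v).
have b2 : 0 < b by lra_end.
have ? := b1.
have cf : {in `]0, b[, continuous f}.
  move=> v vb; apply: cvgM; first exact: weight_continuous.
  apply: cvgB; apply: cvgM.
  - by apply: cvgMl_tmp; exact: exprn_continuous.
  - exact: cD.
  - exact: exprn_continuous.
  - exact: cN.
have fi : leb.-integrable `]0, b[ (EFin \o f).
  pose M := n.+1%:R * k + C.
  apply: (@le_integrable _ _ _ leb _ _ _ (EFin \o (fun v => M * weight v))) => //.
  - apply/measurable_EFinP; apply: continuous_oo_measurable cf _ => z.
    by rewrite in_itv.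
  - move=> v /=; rewrite in_itv /= => vb; have w0 := weight_gt0 vb.
    rewrite lee_fin normrM [leRHS]normrM mulrC ler_pM2r; last by rewrite normr_gt0 gt_eqF.
    have vn : v ^+ n <= 1 by rewrite exprn_ile1//; lra_end.
    have vn0 : 0 <= v ^+ n by rewrite exprn_ge0//; lra_end.
    have Dv : D v <= k.
      apply: le_trans (Dk vb) _; rewrite ler_piMr ?(ltW k0)//; lra_end.
    have Dv0 := D0 vb.
    have h1 : `|n.+1%:R * v ^+ n * D v| <= n.+1%:R * k.
      rewrite ger0_norm; last by rewrite !mulr_ge0// ltW.
      rewrite -mulrA ler_pM2l// -[leRHS]mul1r ler_pM// ltW//.
    have h2 : `|v ^+ n.+1 * N v| <= C.
      apply: le_trans (NC vb).
      by rewrite exprS [v * _]mulrC -mulrA normrM ler_piMl// ger0_norm.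
    apply: le_trans (ler_normB _ _) _; apply: le_trans (ler_norm _).
    exact: lerD.
  - pose w0 v := weight v * v ^+ 0.
    apply: (@eq_integrable _ _ _ leb _ _ (fun v => M%:E * (EFin \o w0) v)%E) => //.
      by move=> v _ /=; rewrite /w0 expr0 mulr1.
    apply: integrableZl => //; exact: weight_moment_integrable.
split=> //; pose F v := v ^+ n.+1 * E v.
apply: (@FTC_improper _ 0 b F f) => //.
- move=> v vb; have vb' : 0 < v < b by move: vb; rewrite in_itv.
  have dE := integrating_factor_derive vb'.
  have dX : is_derive v 1 (fun z => z ^+ n.+1) (n.+1%:R * v ^+ n).
    apply: (DeriveDef (@exprn_derivable _ n.+1 v 1)).
    by rewrite exp_derive /GRing.scale /= mulr1.
  rewrite /F; apply: is_derive_eq; rewrite /f /weight /g /GRing.scale /=.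
  have Dv : D v != 0 by rewrite gt_eqF// D0.
  move: (E v) => y; rewrite exprS; move: (v ^+ n) => t; field.
  exact: Dv.
- apply/cvgr0Pnorm_lt => eps eps0; near=> v.
  have v0 : 0 < v by near: v; exact: nbhs_right_gt.
  have vb : v < b by near: v; exact: nbhs_right_lt.
  have ve : v < eps by near: v; exact: nbhs_right_lt.
  have E1 : E v <= 1 by apply: integrating_factor_le1; rewrite v0.
  have E0 : 0 < E v by exact: expR_gt0.
  rewrite /F ger0_norm ?mulr_ge0 ?exprn_ge0 ?(ltW v0) ?(ltW E0)//.
  apply: le_lt_trans ve; rewrite exprS -mulrA ler_piMr ?(ltW v0)//.
  rewrite mulr_ile1 ?exprn_ge0 ?exprn_ile1 ?(ltW v0) ?(ltW E0)//; lra_end.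
- apply/cvgr0Pnorm_lt => eps eps0.
  move/cvgr0Pnorm_lt : integrating_factor_cvg_right => /(_ _ eps0) h.
  near=> v.
  have v0 : 0 < v by near: v; exact: nbhs_left_gt.
  have vb : v < b by near: v; exact: nbhs_left_lt.
  apply: (@le_lt_trans _ _ `|E v|); last by near: v.
  rewrite /F normrM ler_piMl// normrX exprn_ile1// ger0_norm; lra_end.
Unshelve. all: by end_near. Qed.

End Weight.

(** * The discounted kernel of the generator *)

Section Generator.
Variables (R : realType) (lambda mu : R) (p : nat -> R) (r : int -> R).
Hypothesis hlambda : 0 < lambda.
Hypothesis hmu : 0 <= mu.
Hypothesis hp : is_distribution p.
Hypothesis hp0 : 0 < p 0%N.
Hypothesis hp1 : p 1%N = 0.
Hypothesis hr : is_distribution (fun k : nat => r (k%:Z - 1)).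
Hypothesis hr0 : r 0 = 0.
Variable theta : nat -> R.
Hypothesis theta0 : forall i, 0 <= theta i.

Local Notation Q := (generator lambda mu p r).
Local Notation K := (discounted_kernel Q theta).

(** Vanishes for j = i as p 1 = r 0 = 0, so that the sums below need not exclude
    the diagonal. *)
Definition off_diagonal (i j : nat) : R :=
  if (i <= j.+1)%N then p (j.+1 - i)%N * lambda * i%:R + r (j%:Z - i%:Z) * mu
  else 0.

Let p_ge0 k : 0 <= p k. Proof. by case: hp. Qed.

Let r_ge0 (i j : nat) : (i <= j.+1)%N -> 0 <= r (j%:Z - i%:Z).
Proof.
move=> ij; have [h _] := hr; have := h (j.+1 - i)%N.
by rewrite (_ : (j.+1 - i)%N%:Z - 1 = j%:Z - i%:Z)//; lia.
Qed.

Lemma off_diagonal_ge0 i j : 0 <= off_diagonal i j.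
Proof.
rewrite /off_diagonal; case: ifP => // ij.
by rewrite addr_ge0 ?mulr_ge0 ?r_ge0 ?p_ge0// ltW.
Qed.

Lemma generator_diagonal i : (0 < i)%N -> Q i i = - (lambda * i%:R + mu).
Proof. by rewrite lt0n /generator => /negPf ->; rewrite eqxx. Qed.

Lemma generator_rate i : (0 < i)%N -> 0 < lambda * i%:R + mu.
Proof. by move=> i0; rewrite ltr_pwDl// mulr_gt0// ltr0n. Qed.

Lemma jump_matrix_generator i j : (0 < i)%N ->
  jump_matrix Q i j = off_diagonal i j / (lambda * i%:R + mu).
Proof.
move=> i0; rewrite /jump_matrix generator_diagonal// oppr_eq0 opprK.
rewrite gt_eqF ?generator_rate//; case: eqP => [<-|/eqP ij].
  by rewrite /off_diagonal leqnSn subSnn hp1 subrr hr0 !mul0r addr0 mul0r.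
by rewrite /generator eqn0Ngt i0/= eq_sym (negPf ij).
Qed.

Lemma jump_matrix_generator_ge0 i j : 0 <= jump_matrix Q i j.
Proof.
case: i => [|i]; first by rewrite /jump_matrix /generator /= eqxx ler0n.
by rewrite jump_matrix_generator// divr_ge0 ?off_diagonal_ge0// ltW// generator_rate.
Qed.

Lemma kernel_generator i j : (0 < i)%N ->
  K i j = off_diagonal i j / (lambda * i%:R + mu + theta i).
Proof.
move=> i0; have c0 := generator_rate i0; have ti := theta0 i.
rewrite /discounted_kernel jump_matrix_generator// generator_diagonal// opprK.
by field; apply/andP; split; lra.
Qed.

Lemma kernel_ge0 i j : 0 <= K i j.
Proof.
case: i => [|i]; last first.
  rewrite kernel_generator// divr_ge0 ?off_diagonal_ge0// addr_ge0//.
  by rewrite ltW// generator_rate.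
by rewrite /discounted_kernel /generator /= oppr0 mul0r mulr0.
Qed.

Lemma off_diagonal_eseries i v : 0 <= v <= 1 ->
  (\sum_(0 <= j <oo) (off_diagonal i.+1 j * v ^+ j)%:E)%E =
  (lambda * i.+1%:R * v ^+ i * ptilde p v +
   mu * v ^+ i * ptilde (fun k => r (k%:Z - 1)) v)%:E.
Proof.
move=> hv; have v0 : 0 <= v by case/andP: hv.
rewrite (@nneseries_split _ _ 0 i); last first.
  by move=> k _; rewrite lee_fin mulr_ge0 ?off_diagonal_ge0 ?exprn_ge0.
rewrite big_nat_cond big1 ?add0r; last first.
  move=> k /andP[/andP[_ ki] _]; rewrite /off_diagonal ltnS leqNgt.
  by rewrite add0n in ki; rewrite ki mul0r.
rewrite add0n -nneseries_addn; last first.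
  by move=> k; rewrite lee_fin mulr_ge0 ?off_diagonal_ge0 ?exprn_ge0.
rewrite EFinD [(lambda * _ * _ * _)%:E]EFinM [(mu * _ * _)%:E]EFinM.
have hpv k := andP (pgf_term_le hp hv k).
have hrv k := andP (pgf_term_le hr hv k).
have l0 : 0 <= lambda * i.+1%:R * v ^+ i by rewrite !mulr_ge0 ?exprn_ge0// ltW.
have m0 : 0 <= mu * v ^+ i by rewrite mulr_ge0 ?exprn_ge0.
rewrite -(ptilde_eseries hp hv) -(ptilde_eseries hr hv) -!nneseriesZl; first last.
- by move=> k _; rewrite lee_fin; case: (hpv k).
- by move=> k _; rewrite lee_fin; case: (hrv k).
rewrite -nneseriesD; first last.
- by move=> k _ _; rewrite mule_ge0 ?lee_fin//; case: (hrv k).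
- by move=> k _ _; rewrite mule_ge0 ?lee_fin//; case: (hpv k).
apply: eq_eseriesr => k _; rewrite -!EFinM -EFinD; congr EFin.
rewrite /off_diagonal ltnS leq_addl.
rewrite (_ : ((k + i).+1 - i.+1)%N = k); last by lia.
rewrite (_ : (k + i)%N%:Z - i.+1%:Z = k%:Z - 1); last by lia.
by rewrite exprD; ring.
Qed.

Lemma kernel_skipfree i j : (0 < i)%N -> (j.+1 < i)%N -> K i j = 0.
Proof.
by move=> i0 ji; rewrite kernel_generator// /off_diagonal leqNgt ji mul0r.
Qed.

Lemma kernel_down i : (0 < i)%N -> 0 < K i i.-1.
Proof.
move=> i0; rewrite kernel_generator// divr_gt0//; last first.
  by rewrite ltr_pwDl// generator_rate.
rewrite /off_diagonal prednK// leqnn subnn ltr_pwDl ?mulr_gt0 ?ltr0n//.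
by rewrite mulr_ge0// r_ge0// prednK.
Qed.

(** The kernel is the off-diagonal part of the generator divided by the total
    rate lambda i + mu + theta i. *)
Lemma kernel_harmonic i (f : nat -> R) (y : R) : (0 < i)%N -> (forall j, 0 <= f j) ->
  (\sum_(0 <= j <oo) (off_diagonal i j * f j)%:E)%E = y%:E ->
  (\sum_(0 <= j <oo) (K i j * f j)%:E)%E = (y / (lambda * i%:R + mu + theta i))%:E.
Proof.
move=> i0 f0 fy; rewrite [y / _]mulrC EFinM -fy -nneseriesZl; last first.
  by move=> j _; rewrite lee_fin mulr_ge0// off_diagonal_ge0.
apply: eq_eseriesr => j _; rewrite -EFinM kernel_generator//; congr EFin; ring.
Qed.

Lemma kernel_substochastic i : (0 < i)%N -> (\sum_(0 <= j <oo) (K i j)%:E <= 1)%E.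
Proof.
move=> i0; have := @off_diagonal_eseries i.-1 1; rewrite prednK//.
have -> : (\sum_(0 <= j <oo) (K i j)%:E = \sum_(0 <= j <oo) (K i j * 1 ^+ j)%:E)%E.
  by apply: eq_eseriesr => j _; rewrite expr1n mulr1.
move=> h; rewrite (kernel_harmonic i0 _ (h _));
  [|by move=> j; rewrite expr1n|by rewrite ler01 lexx].
rewrite !expr1n !ptilde1// !mulr1 lee_fin ler_pdivrMr ?mul1r ?lerDl//.
by rewrite ltr_pwDl// generator_rate.
Qed.

End Generator.

(** * The moments of the weight *)

Section Moments.
Variables (R : realType) (lambda mu : R) (p : nat -> R) (r : int -> R).
Variables (q qbar : R).
Hypothesis hlambda : 0 < lambda.
Hypothesis hmu : 0 <= mu.
Hypothesis hp : is_distribution p.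
Hypothesis hp0 : 0 < p 0%N.
Hypothesis hp1 : p 1%N = 0.
Hypothesis hr : is_distribution (fun k : nat => r (k%:Z - 1)).
Hypothesis hr0 : r 0 = 0.
Hypothesis hq : 0 <= q.
Hypothesis hqbar : 0 <= qbar.

Local Notation leb := (@lebesgue_measure R).
Let b := varphi lambda p qbar.
Let c := phi mu r q.
Let D := denominator lambda p qbar.
Let N (w : R) := q + mu * (1 - rtilde r w).

Hypothesis hqb : 0 < q \/ b < 1.
Hypothesis hN : mu * (rtilde r b - 1) < q.

Let b01 : 0 < b <= 1.
Proof. by have [] := varphi_spec hp hp0 hlambda hqbar. Qed.

Let in01 v : 0 < v < b -> 0 <= v <= 1.
Proof. by have := b01; lra. Qed.

Let DE v : 0 < v -> D v = lambda * v * (ptilde p v / v - (1 + qbar / lambda)).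
Proof.
move=> v0; rewrite /D /denominator; field; apply/andP; split; rewrite gt_eqF//.
Qed.

Let D_gt0 v : 0 < v < b -> 0 < D v.
Proof.
move=> vb; have [_ _ _ lo _] := varphi_spec hp hp0 hlambda hqbar.
have /andP[v0 _] := vb.
by rewrite DE// !mulr_gt0// subr_gt0; exact: lo.
Qed.

Let D_b : D b = 0.
Proof.
have [_ bE _ _ _] := varphi_spec hp hp0 hlambda hqbar.
by rewrite DE ?(andP b01).1// bE subrr mulr0.
Qed.

Let D_lip v : 0 < v < b -> D v <= (lambda + qbar) * (b - v).
Proof.
move=> vb; rewrite -[leLHS]subr0 -D_b /D /denominator.
have vb' : v <= b by case/andP: vb => _ /ltW.
have : lambda * ptilde p v <= lambda * ptilde p b.
  rewrite ler_pM2l// ptilde_mono//; have := b01; lra.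
lra.
Qed.

Let D_within v : v < b -> {within `[0, v], continuous D}.
Proof.
move=> vb; have sub : `[0, v] `<=` `[0, 1].
  by apply: subset_itvl; rewrite bnd_simp; have := b01; lra.
have cp := continuous_subspaceW sub (ptilde_continuous hp).
move=> z; apply: cvgB.
  apply: cvgMl_tmp; apply: cvgB; first exact: cp.
  by apply: continuous_subspaceT => {}z; exact: cvg_id.
apply: cvgMl_tmp.
by apply: continuous_subspaceT => {}z; exact: cvg_id.
Qed.

Let D_at0 : 0 < D 0.
Proof. by rewrite /D /denominator ptilde_at0// subr0 mulr0 subr0 mulr_gt0. Qed.

Let D_low v : v < b -> exists2 l : R, 0 < l & forall z : R, 0 <= z <= v -> l <= D z.
Proof.
move=> vb; have [v0|v0] := ltP v 0.
  by exists 1 => // z zv; lra.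
have [z zv zmin] := EVT_min v0 (D_within vb).
exists (D z); last by move=> y yv; apply: zmin; rewrite in_itv.
move: zv; rewrite in_itv /= => /andP[]; rewrite le_eqVlt => /orP[/eqP <- //|z0 zv].
by apply: D_gt0; rewrite z0 (le_lt_trans zv).
Qed.

Let ptilde_cont_oo (s : nat -> R) : is_distribution s ->
  {in `]0, b[, continuous (ptilde s)}.
Proof.
move=> hs v; rewrite in_itv /= => vb.
have /continuous_within_itvP [|h _ _] := ptilde_continuous hs; first exact: ltr01.
by apply: h; rewrite in_itv /=; have := b01; lra.
Qed.

Let cD : {in `]0, b[, continuous D}.
Proof.
move=> v vb; apply: cvgB; apply: cvgMl_tmp; last exact: cvg_id.
by apply: cvgB; [exact: ptilde_cont_oo|exact: cvg_id].
Qed.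

Let s (k : nat) := r (k%:Z - 1).

Let rE v : 0 < v < b -> rtilde r v = ptilde s v / v.
Proof. by move=> vb; rewrite rtilde_ptilde//; have := in01 vb; lra. Qed.

Let cN : {in `]0, b[, continuous N}.
Proof.
move=> v vb; apply: cvgD; first exact: cvg_cst.
apply: cvgMl_tmp; apply: cvgB; first exact: cvg_cst.
have vb' : 0 < v < b by move: vb; rewrite in_itv.
rewrite rE//; apply: (@cvg_trans _ ((ptilde s z / z) @[z --> v])); last first.
  have h1 : ptilde s z @[z --> v] --> ptilde s v := ptilde_cont_oo hr vb.
  have h2 : z^-1 @[z --> v] --> v^-1.
    by apply: cvgV; [rewrite gt_eqF//; lra|exact: cvg_id].
  exact: cvgM h1 h2.
apply: near_eq_cvg; near=> z; rewrite rE//; apply/andP; split.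
  by near: z; apply: lt_nbhsr; lra.
by near: z; apply: lt_nbhsl; lra.
Unshelve. all: by end_near. Qed.

Let vN v : 0 < v < b -> `|v * N v| <= q + mu.
Proof.
move=> vb; rewrite /N rE//.
have -> : v * (q + mu * (1 - ptilde s v / v)) = q * v + mu * (v - ptilde s v).
  by field; rewrite gt_eqF//; case/andP: vb.
have h0 := ptilde_ge0 hr (in01 vb); have h1 := ptilde_le1 hr (in01 vb).
have v01 := in01 vb.
apply: le_trans (ler_normD _ _) _; rewrite !normrM (ger0_norm hq) (ger0_norm hmu).
apply: lerD; rewrite ler_piMr//; first by rewrite ger0_norm; lra.
by rewrite ler_norml; lra.
Qed.

(** If mu r_(-1) > 0 then N changes sign at phi; otherwise phi = 0 and N >= 0,
    because mu = 0 or rtilde <= 1. *)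
Let c_spec : [/\ 0 <= c, c < b, forall v, 0 < v < c -> N v <= 0
  & forall v, c < v < b -> 0 <= N v].
Proof.
have [mu0|mu0] := ltP 0 mu; last first.
  have mu00 : mu = 0 by apply/eqP; rewrite eq_le hmu mu0.
  have c0 : c = 0 by rewrite /c /phi mu00 mul0r ltxx.
  rewrite c0; split=> //; first by have := b01; lra.
    by move=> v; lra.
  by move=> v _; rewrite /N mu00 mul0r addr0.
have cb : c < b by apply/lt_phi.
have [r1|r1] := ltP 0 (r (-1)).
  have [h1 h2 _ lo hi] := phi_spec hr mu0 r1 hq.
  have NE v : N v = mu * (1 + q / mu - rtilde r v).
    by rewrite /N; field; rewrite gt_eqF.
  split=> //; first by rewrite ltW//; case/andP: h1.
    by move=> v vc; rewrite NE pmulr_rle0// subr_le0 ltW// lo.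
  move=> v /andP[cv vb]; rewrite NE pmulr_rge0// subr_ge0 ltW// hi// cv /=.
  by have := b01; lra.
have r10 : r (-1) = 0 by have [h _] := hr; have := h 0%N; rewrite sub0r; lra.
have c0 : c = 0 by rewrite /c /phi r10 mulr0 ltxx.
rewrite c0; split=> //; first by have := b01; lra.
  by move=> v; lra.
move=> v vb; have := rtilde_up_le hr r10 hr0 (in01 vb); have := in01 vb => v01 h.
by rewrite /N addr_ge0// mulr_ge0//; lra.
Qed.

(** N is continuous from the left at b, where it is positive by hN. *)
Let N_end : exists e b0 : R, [/\ 0 < e, c <= b0, b0 < b
  & forall v, b0 < v < b -> e <= N v].
Proof.
have [c0 cb _ _] := c_spec.
pose e := (q - mu * (rtilde r b - 1)) / 2.
have e0 : 0 < e by rewrite divr_gt0// subr_gt0.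
have b0 : 0 < b by case/andP: b01.
have lim : N v @[v --> b^'-] --> N b.
  apply: cvgD; first exact: cvg_cst.
  apply: cvgMl_tmp; apply: cvgB; first exact: cvg_cst.
  rewrite rtilde_ptilde//; apply: (@cvg_trans _ ((ptilde s v / v) @[v --> b^'-])).
    apply: near_eq_cvg; near=> z; rewrite rE//; apply/andP; split.
      by near: z; exact: nbhs_left_gt.
    by near: z; exact: nbhs_left_lt.
  have h2 : z^-1 @[z --> b^'-] --> b^-1.
    by apply: cvg_at_left_filter; apply: cvgV; [rewrite gt_eqF|exact: cvg_id].
  suff h1 : ptilde s z @[z --> b^'-] --> ptilde s b by exact: cvgM h1 h2.
  have sub : `[0, b] `<=` `[0, 1].
    by apply: subset_itvl; rewrite bnd_simp; case/andP: b01.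
  have := continuous_subspaceW sub (ptilde_continuous hr).
  by move/(continuous_within_itvP _ b0) => [].
have : \forall v \near b^'-, e < N v.
  apply: (cvgr_gt _ lim); rewrite /N /e.
  by move: hN; move: (rtilde r b) => y; lra.
move=> [d /= d0 hd].
pose m := Num.max c (b - d).
exists e, m; split=> //.
- by rewrite /m le_max lexx.
- by rewrite /m gt_max cb; lra.
move=> v; rewrite /m gt_max => /andP[/andP[cv dv] vb].
apply/ltW/hd => //=.
by rewrite ger0_norm; lra.
Unshelve. all: by end_near. Qed.

(** For c = 0 the point 0 belongs to the interval of integration; then
    mu r_(-1) = 0 and N extends continuously to 0. *)
Let gi v : c < v < b -> leb.-integrable `[c, v] (EFin \o (fun w => N w / D w)).
Proof.
move=> /andP[cv vb]; have [c0 cb _ _] := c_spec.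
move: c0; rewrite le_eqVlt => /orP[/eqP c0|c0]; last first.
  apply: (continuous_oo_integrable (a := 0) (b := b)) => //.
  move=> z zb; apply: cvgM; first exact: cN.
  apply: cvgV; last exact: cD.
  by rewrite gt_eqF// D_gt0//; move: zb; rewrite in_itv.
rewrite -c0; apply: continuous_compact_integrable; first exact: segment_compact.
have sub : `[0, v] `<=` `[0, 1].
  by apply: subset_itvl; rewrite bnd_simp; have := b01; lra.
have cNw : {within `[0, v], continuous N}.
  have [mu0|mu0] := eqVneq mu 0.
    apply: continuous_subspaceT => z; rewrite /N mu0.
    under eq_fun do rewrite mul0r addr0; exact: cvg_cst.
  have r1 : r (-1) = 0.
    have [r1|r1] := ltP 0 (r (-1)); last first.
      by have [h _] := hr; have := h 0%N; rewrite sub0r; lra.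
    have mu1 : 0 < mu by rewrite lt_neqAle eq_sym mu0.
    by have [] := phi_spec hr mu1 r1 hq; rewrite -/c; lra.
  apply: (@subspace_eq_continuous _ _ _
    (fun w => q + mu * (1 - ptilde (fun k => r k%:Z) w))).
    move=> w /set_mem /sub; rewrite /= in_itv /= => w01.
    by rewrite /from_subspace /N rtilde_up.
  have cp := continuous_subspaceW sub (ptilde_continuous (up_distribution hr r1)).
  move=> z; apply: cvgD; first exact: cvg_cst.
  by apply: cvgMl_tmp; apply: cvgB; [exact: cvg_cst|exact: cp].
have [l l0 lD] := D_low vb.
apply/subspace_continuousP => z zv; have zv' : 0 <= z <= v by move: zv; rewrite /= in_itv.
apply: cvgM; first by move/subspace_continuousP : cNw; apply.
apply: cvgV; first by rewrite gt_eqF// (lt_le_trans l0)// lD.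
by move/subspace_continuousP : (D_within vb); apply.
Qed.

Let M := weighted_moment lambda p qbar N c.

Let moments : exists2 w : R -> R, {in `]0, b[, continuous w} &
  [/\ forall v : R, 0 < v < b -> 0 < w v,
      forall n, leb.-integrable `]0, b[ (EFin \o (fun v => w v * v ^+ n)),
      forall n, M n = \int[leb]_(v in `]0, b[) (w v * v ^+ n)
    & forall n, leb.-integrable `]0, b[
        (EFin \o (fun v => w v * (n.+1%:R * v ^+ n * D v - v ^+ n.+1 * N v))) /\
      (\int[leb]_(v in `]0%R, b[)
         (w v * (n.+1%:R * v ^+ n * D v - v ^+ n.+1 * N v))%:E = 0)%E].
Proof.
have [c0 cb Nneg Npos] := c_spec; have [e [b0 [e0 cb0 b0b Ne]]] := N_end.
have k0 : 0 < lambda + qbar by rewrite ltr_pwDl.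
have b1 : b <= 1 by case/andP: b01.
have Dl v : v < b -> exists2 l : R, 0 < l & forall z : R, 0 < z <= v -> l <= D z.
  move=> /D_low[l l0 h]; exists l => // z /andP[z0 zv]; apply: h.
  by rewrite (ltW z0).
exists (weight N D c).
  exact: (weight_continuous c0 cb cN cD D_gt0 gi).
split.
- by move=> v vb; exact: (weight_gt0 N c D_gt0 vb).
- move=> n; exact: (weight_moment_integrable c0 cb cN cD D_gt0 gi Nneg Npos
    e0 cb0 b0b Ne Dl b1 n).
- by [].
- move=> n; exact: (weight_balance c0 cb cN cD D_gt0 gi Nneg Npos
    e0 cb0 b0b Ne k0 D_lip Dl b1 vN n).
Qed.

Let MofE (w : R -> R) n :
  leb.-integrable `]0, b[ (EFin \o (fun v => w v * v ^+ n)) ->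
  M n = \int[leb]_(v in `]0, b[) (w v * v ^+ n) ->
  (M n)%:E = (\int[leb]_(v in `]0%R, b[) (w v * v ^+ n)%:E)%E.
Proof. by move=> wi ->; rewrite fineK//; exact: integrable_fin_num wi. Qed.

(** A continuous positive function is bounded below by a positive constant on the
    segment [b/4, b/2]. *)
Lemma weighted_moment_gt0 n : 0 < M n.
Proof.
have [w cw [w0 wi ME _]] := moments.
have b0 : 0 < b by case/andP: b01.
have cwn : {within `[b / 4, b / 2], continuous (fun v => w v * v ^+ n)}.
  apply: (continuous_oo_within (a := 0) (b := b)).
    by move=> v vb; apply: cvgM; [exact: cw|exact: exprn_continuous].
  by move=> z; rewrite in_itv /=; lra.
have [|m mI mmin] := EVT_min _ cwn; first by lra.
have m0 : 0 < w m * m ^+ n.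
  move: mI; rewrite in_itv /= => mI.
  by rewrite mulr_gt0 ?exprn_gt0 ?w0//; lra.
rewrite -lte_fin (MofE (wi n) (ME n)).
apply: (@lt_le_trans _ _ (\int[leb]_(v in `[(b / 4)%R, (b / 2)%R]) (w m * m ^+ n)%:E)%E).
  rewrite integral_cst//= lebesgue_measure_itv /= lte_fin ifT; last lra.
  by rewrite -EFinB -EFinM lte_fin mulr_gt0//; lra.
apply: (@le_trans _ _ (\int[leb]_(v in `[(b / 4)%R, (b / 2)%R]) (w v * v ^+ n)%:E)%E).
  apply: ge0_le_integral => //.
  - by move=> v _; rewrite lee_fin ltW.
  - by apply/measurable_EFinP; exact: subspace_continuous_measurable_fun.
apply: ge0_subset_integral => //.
- exact: (measurable_int leb (wi n)).
- move=> v /=; rewrite in_itv /= => vb; rewrite lee_fin mulr_ge0 ?exprn_ge0//.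
    by rewrite ltW// w0.
  by case/andP: vb => /ltW.
- by move=> v /=; rewrite !in_itv /=; lra.
Qed.

Lemma weighted_moment_cvg0 : M @ \oo --> (0 : R).
Proof.
have [w cw [w0 wi ME _]] := moments.
pose f n v := (w v * v ^+ n)%:E.
have : (fun n => \int[leb]_(v in `]0%R, b[) f n v)%E @ \oo -->
    (\int[leb]_(v in `]0%R, b[) (cst 0%E v))%E.
  have [] // := @dominated_convergence _ _ _ leb `]0, b[%classic _ f (cst 0%E)
    (EFin \o (fun v => w v * v ^+ 0)).
  - by move=> n; exact: (measurable_int leb (wi n)).
  - apply: aeW => v /=; rewrite in_itv /= => vb; apply: cvg_EFin; first exact: nearW.
    rewrite /f /= -(mulr0 (w v)); apply: cvgMl_tmp; apply: cvg_expr.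
    by rewrite ger0_norm; have := in01 vb; have := b01; lra.
  - apply: aeW => v n /=; rewrite in_itv /= => vb.
    have wv := w0 v vb; have v01 := in01 vb; have v0 : 0 <= v by case/andP: v01.
    rewrite /f lee_fin expr0 mulr1 ger0_norm ?mulr_ge0 ?exprn_ge0 ?(ltW wv)//.
    by rewrite ler_piMr ?(ltW wv)// exprn_ile1//; case/andP: v01.
rewrite integral0 => h.
have : (fun n => (M n)%:E) @ \oo --> 0%E.
  by under eq_fun do rewrite (MofE (wi _) (ME _)).
by move/fine_cvg.
Qed.

(** By weight_balance, since n v^(n-1) D - v^n N is the generator minus the
    discount, applied to the powers v^j. *)
Lemma weighted_moment_harmonic n :
  (\sum_(0 <= j <oo) (off_diagonal lambda mu p r n.+1 j * M j)%:E)%E =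
  ((lambda * n.+1%:R + mu + (q + qbar * n.+1%:R)) * M n.+1)%:E.
Proof.
have [w cw [w0 wi ME bal]] := moments.
have [bi b0] := bal n.
set rate := lambda * _ + _ + _.
have rate0 : 0 <= rate by rewrite !addr_ge0 ?mulr_ge0// ltW.
have off0 := off_diagonal_ge0 hlambda hmu hp hp0 hr.
under eq_eseriesr => j _.
  rewrite EFinM (MofE (wi _) (ME _)) -ge0_integralZl_EFin//; first last.
  - exact: (measurable_int leb (wi j)).
  - move=> v /=; rewrite in_itv /= => vb; rewrite lee_fin mulr_ge0//.
      by rewrite ltW// w0.
    by rewrite exprn_ge0//; case/andP: (in01 vb).
  over.
rewrite -integral_nneseries//; first last.
- move=> j v /=; rewrite in_itv /= => vb; rewrite mule_ge0 ?lee_fin// mulr_ge0//.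
    by rewrite ltW// w0.
  by rewrite exprn_ge0//; case/andP: (in01 vb).
- by move=> j; apply: measurable_funeM; exact: (measurable_int leb (wi j)).
transitivity (\int[leb]_(v in `]0%R, b[) (rate%:E * (w v * v ^+ n.+1)%:E +
   (w v * (n.+1%:R * v ^+ n * D v - v ^+ n.+1 * N v))%:E))%E.
  apply: eq_integral => v /set_mem; rewrite /= in_itv /= => vb.
  have v0 : 0 < v by case/andP: vb.
  under eq_eseriesr do rewrite -EFinM mulrCA EFinM.
  rewrite nneseriesZl; last by move=> j _; rewrite lee_fin mulr_ge0// exprn_ge0// ltW.
  rewrite (off_diagonal_eseries hlambda hmu hp hp0 hr _ (in01 vb)).
  rewrite -!EFinM -EFinD; congr EFin; rewrite /rate /N rE// /D /denominator exprS.
  by field; rewrite gt_eqF.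
rewrite integralD//; last exact: (integrableZl _ _ (wi n.+1)).
rewrite b0 adde0 EFinM (MofE (wi _) (ME _)) integralZl//.
exact: wi.
Qed.

Lemma passage_value_moment (a x : nat) : (a <= x)%N ->
  passage_value (discounted_kernel (generator lambda mu p r)
    (fun i => q + qbar * i%:R)) a x = (M x / M a)%:E.
Proof.
set t := fun i => _; set K := discounted_kernel _ t.
have t0 i : 0 <= t i by rewrite addr_ge0// mulr_ge0.
have M0 := weighted_moment_gt0.
apply: (passage_value_harmonic (h := fun j => M j / M a)) => [i j|i j ai|i ai|i ai|i|||i ai].
- exact: (kernel_ge0 hlambda hmu hp hp0 hp1 hr hr0 t0).
- exact: (kernel_skipfree hlambda hmu hp1 hr0 t0 (leq_ltn_trans (leq0n a) ai)).
- exact: (kernel_down hlambda hmu hp0 hp1 hr hr0 t0 (leq_ltn_trans (leq0n a) ai)).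
- exact: (kernel_substochastic hlambda hmu hp hp0 hp1 hr hr0 t0 (leq_ltn_trans (leq0n a) ai)).
- by rewrite divr_ge0// ltW.
- by rewrite divff// gt_eqF.
- by rewrite -(mul0r (M a)^-1); apply: cvgMr_tmp; exact: weighted_moment_cvg0.
case: i ai => // i ai; set y := (RHS).
have Ma := M0 a; have Mi := M0 i.+1.
rewrite (kernel_harmonic (y := (lambda * i.+1%:R + mu + t i.+1) * M i.+1 / M a)
  hlambda hmu hp hp0 hp1 hr hr0 t0)//.
- have : 0 < lambda * i.+1%:R + mu + t i.+1.
    by rewrite ltr_pwDl// (generator_rate hlambda hmu).
  rewrite /y; move: (lambda * _ + _ + _) => rate rate0.
  by congr EFin; field; rewrite !gt_eqF.
- by move=> j; rewrite divr_ge0// ltW.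
rewrite [X in _ = X%:E]mulrC EFinM -weighted_moment_harmonic -nneseriesZl; last first.
  move=> j _; rewrite lee_fin mulr_ge0//; last by rewrite ltW.
  exact: (off_diagonal_ge0 hlambda hmu hp hp0 hr).
by apply: eq_eseriesr => j _; rewrite -EFinM; congr EFin; ring.
Qed.

End Moments.

(** * The transforms of the chain *)

Lemma passage_transform_kernel (R : realType) (lambda mu : R) (p : nat -> R)
    (r : int -> R) (d : measure_display) (Omega : measurableType d)
    (P : nat -> probability Omega R) (X : R -> Omega -> option nat)
    (a x : nat) (q qbar : R) :
  0 < lambda -> 0 <= mu -> is_distribution p -> 0 < p 0%N -> p 1%N = 0 ->
  is_distribution (fun k : nat => r (k%:Z - 1)) -> r 0 = 0 ->
  0 <= q -> 0 <= qbar ->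
  minimal_markov_chain (generator lambda mu p r) P X ->
  passage_transform (P x) X a q qbar =
  passage_value (discounted_kernel (generator lambda mu p r)
    (fun i => q + qbar * i%:R)) a x.
Proof.
move=> hl hm hp hp0 hp1 hr hr0 hq hqb [mX hX hY hH].
apply: (passage_transformE mX hX (hY x) (hH x)) => //.
- move=> i ai; have i0 := leq_ltn_trans (leq0n a) ai.
  by rewrite generator_diagonal// oppr_lt0 generator_rate.
- case=> [|i]; first by rewrite /generator.
  by rewrite generator_diagonal// oppr_le0 ltW// generator_rate.
- by move=> i; rewrite addr_ge0// mulr_ge0.
- exact: (jump_matrix_generator_ge0 hl hm hp hp0 hp1 hr hr0).
Qed.

Section PureBranching.
Variables (R : realType) (lambda : R) (p : nat -> R) (r : int -> R).
Hypothesis hlambda : 0 < lambda.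
Hypothesis hp : is_distribution p.
Hypothesis hp0 : 0 < p 0%N.
Hypothesis hp1 : p 1%N = 0.
Hypothesis hr : is_distribution (fun k : nat => r (k%:Z - 1)).
Hypothesis hr0 : r 0 = 0.
Local Notation K qbar :=
  (discounted_kernel (generator lambda 0 p r) (fun i => 0 + qbar * i%:R)).

Let t0 (qbar : R) (i : nat) : 0 <= qbar -> 0 <= 0 + qbar * i%:R.
Proof. by move=> h; rewrite addr_ge0// mulr_ge0. Qed.

(** Without the mu terms the sum over j of the off-diagonal rates times b^j is
    lambda i b^(i-1) ptilde b, which the equation for b turns into a multiple of
    b^i. *)
Let power_harmonic (qbar b : R) i : 0 <= qbar -> 0 < b <= 1 ->
  ptilde p b / b = 1 + qbar / lambda ->
  (\sum_(0 <= j <oo) (K qbar i.+1 j * b ^+ j)%:E = (b ^+ i.+1)%:E)%E.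
Proof.
move=> hq /andP[b0 b1] bE; have hb : 0 <= b <= 1 by rewrite ltW.
have tq j := t0 j hq.
rewrite (kernel_harmonic hlambda (lexx 0) hp hp0 hp1 hr hr0 tq (ltn0Sn i) _
  (off_diagonal_eseries hlambda (lexx 0) hp hp0 hr i hb)); last first.
  by move=> j; rewrite exprn_ge0// ltW.
have -> : ptilde p b = b * (1 + qbar / lambda).
  by rewrite -bE mulrC divfK// gt_eqF.
have i0 : 0 < i.+1%:R :> R by [].
have h1 : 0 < (lambda + qbar) * i.+1%:R by rewrite mulr_gt0// ltr_pwDl.
congr EFin; rewrite exprS; move: (b ^+ i) (i.+1%:R : R) i0 h1 => y n i0 h1.
field; apply/andP; split; rewrite gt_eqF//.
by move: h1; rewrite mulrDl; lra.
Qed.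

Let passage_value_power_lt1 (qbar b : R) a x : 0 <= qbar -> 0 < b < 1 ->
  ptilde p b / b = 1 + qbar / lambda -> (a <= x)%N ->
  passage_value (K qbar) a x = (b ^+ (x - a))%:E.
Proof.
move=> hq /andP[b0 b1] bE ax.
have tq j := t0 j hq.
have b01 : 0 < b <= 1 by rewrite b0 ltW.
have -> : b ^+ (x - a) = b ^+ x / b ^+ a by rewrite -expfB_cond// gt_eqF.
apply: (passage_value_harmonic (h := fun j => b ^+ j / b ^+ a))
    => // [i j|i j ai|i ai|i ai|i|||i ai].
- exact: (kernel_ge0 hlambda (lexx 0) hp hp0 hp1 hr hr0 tq).
- exact: (kernel_skipfree hlambda (lexx 0) hp1 hr0 tq (leq_ltn_trans (leq0n a) ai)).
- exact: (kernel_down hlambda (lexx 0) hp0 hp1 hr hr0 tq (leq_ltn_trans (leq0n a) ai)).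
- exact: (kernel_substochastic hlambda (lexx 0) hp hp0 hp1 hr hr0 tq
    (leq_ltn_trans (leq0n a) ai)).
- by rewrite divr_ge0// exprn_ge0// ltW.
- by rewrite divff// gt_eqF// exprn_gt0.
- rewrite -(mul0r (b ^+ a)^-1); apply: cvgMr_tmp; apply: cvg_expr.
  by rewrite ger0_norm ?ltW.
case: i ai => // i ai; rewrite [in RHS]mulrC EFinM -(power_harmonic i hq b01 bE).
rewrite -nneseriesZl; last first.
  move=> j _; rewrite lee_fin mulr_ge0//; last by rewrite exprn_ge0// ltW.
  exact: (kernel_ge0 hlambda (lexx 0) hp hp0 hp1 hr hr0 tq).
by apply: eq_eseriesr => j _; rewrite -EFinM; congr EFin; ring.
Qed.

(** If the smallest root is 1, no positive power of it vanishes at infinity; then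
    the value is squeezed between 1 and the values z ^ (x - a), z < 1, which
    belong to the larger discounting rates for which z is the root. *)
Lemma passage_value_power (qbar : R) a x : 0 <= qbar -> (a <= x)%N ->
  passage_value (K qbar) a x = (varphi lambda p qbar ^+ (x - a))%:E.
Proof.
move=> hq ax; have [/andP[b0 b1] bE qb lo _] := varphi_spec hp hp0 hlambda hq.
set b := varphi lambda p qbar in b0 b1 bE qb lo *.
move: b1; rewrite le_eqVlt => /orP[/eqP b1|b1]; last first.
  by apply: passage_value_power_lt1 => //; rewrite b0.
have q0 : qbar = 0.
  apply/eqP; rewrite eq_le hq andbT leNgt; apply/negP => /qb.
  by rewrite b1 ltxx.
rewrite b1 expr1n; move: lo; rewrite q0 b1 mul0r addr0 => lo {qb bE}.
have tq j := t0 j (lexx (0 : R)).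
have le1 : (passage_value (K 0) a x <= 1%:E)%E.
  apply: (@passage_value_le _ (K 0) a (fun=> 1)) => // [i j|i j ai|i ai].
  - exact: (kernel_ge0 hlambda (lexx 0) hp hp0 hp1 hr hr0 tq).
  - exact: (kernel_skipfree hlambda (lexx 0) hp1 hr0 tq (leq_ltn_trans (leq0n a) ai)).
  - under eq_eseriesr do rewrite mulr1.
    exact: (kernel_substochastic hlambda (lexx 0) hp hp0 hp1 hr hr0 tq
      (leq_ltn_trans (leq0n a) ai)).
have ge z : 0 < z < 1 -> ((z ^+ (x - a))%:E <= passage_value (K 0) a x)%E.
  move=> z01; pose q' := lambda * (ptilde p z / z - 1).
  have q'0 : 0 <= q' by rewrite mulr_ge0 ?(ltW hlambda)// subr_ge0 ltW// lo.
  have zE : ptilde p z / z = 1 + q' / lambda.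
    by rewrite /q'; field; case/andP: z01 => z0 _; rewrite !gt_eqF.
  rewrite -(passage_value_power_lt1 q'0 z01 zE ax).
  have tq' j := t0 j q'0.
  have K0 := kernel_ge0 hlambda (lexx 0) hp hp0 hp1 hr hr0 tq'.
  apply: lee_nneseries => [n _ _|n _]; first exact: passage_weight_ge0.
  apply: passage_weight_mono => // -[|i] j.
    by rewrite /discounted_kernel /generator /= oppr0 !mul0r mulr0.
  rewrite !(kernel_generator hlambda (lexx 0) hp1 hr0)// ler_wpM2l//.
    exact: (off_diagonal_ge0 hlambda (lexx 0) hp hp0 hr).
  have l0 : 0 < lambda * i.+1%:R by rewrite mulr_gt0.
  have q1 : 0 <= q' * i.+1%:R by rewrite mulr_ge0.
  by rewrite mul0r lef_pV2 ?posrE; lra.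
have fin : passage_value (K 0) a x \is a fin_num.
  rewrite ge0_fin_numE ?(le_lt_trans le1) ?ltry//.
  by apply: le_trans (ge 2^-1 _); rewrite ?lee_fin ?exprn_ge0//; lra.
apply/eqP; rewrite eq_le le1 /= -(fineK fin) lee_fin.
have cz : z ^+ (x - a) @[z --> 1^'-] --> (1 : R).
  rewrite -[X in _ --> X](expr1n _ (x - a)); apply: cvg_at_left_filter.
  exact: exprn_continuous.
apply: (@cvgr_to_le _ _ _ _ _ _ _ cz); near=> z; rewrite -lee_fin fineK//; apply: ge.
apply/andP; split; near: z; last exact: nbhs_left_lt.
by apply: nbhs_left_gt; exact: ltr01.
Unshelve. all: by end_near. Qed.

End PureBranching.

Theorem corollary4p14 (R : realType) (lambda mu : R) (p : nat -> R)
    (r : int -> R) (d : measure_display) (Omega : measurableType d)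
    (P : nat -> probability Omega R) (X : R -> Omega -> option nat)
    (hlambda : 0 < lambda) (hmu : 0 <= mu)
    (hp : is_distribution p) (hp0 : 0 < p 0%N) (hp1 : p 1%N = 0)
    (hr : is_distribution (fun k : nat => r (k%:Z - 1))) (hr0 : r 0 = 0)
    (hup : (exists k : nat, (1 <= k)%N /\ 0 < mu * r k%:Z) \/ p 0%N < 1)
    (hX : minimal_markov_chain (generator lambda mu p r) P X)
    (a x : nat) (hax : (a <= x)%N)
    (q qbar : R) (hq : 0 <= q) (hqbar : 0 <= qbar) :
  [/\ 0 < q \/ varphi lambda p qbar < 1 ->
        (0 < mu ->
           (mu * (rtilde r (varphi lambda p qbar) - 1) < q <->
            phi mu r q < varphi lambda p qbar)) /\
        (mu * (rtilde r (varphi lambda p qbar) - 1) < q ->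
           passage_transform (P x) X a q qbar =
           (Phi lambda mu p r q qbar x / Phi lambda mu p r q qbar a)%:E),
      r (-1) = 0 -> 0 < mu -> 0 < qbar ->
        passage_transform (P x) X a 0 qbar =
        (weighted_moment lambda p qbar
           (fun w => mu * (1 - rtilde r w)) 0 x /
         weighted_moment lambda p qbar
           (fun w => mu * (1 - rtilde r w)) 0 a)%:E
    & mu = 0 ->
        passage_transform (P x) X a 0 qbar =
        (varphi lambda p qbar ^+ (x - a))%:E].
Proof.
have [b01 _ qb _ _] := varphi_spec hp hp0 hlambda hqbar.
split.
- move=> hqb; split=> [mu0|hN]; first exact: lt_phi.
  rewrite (passage_transform_kernel _ _ hlambda hmu hp hp0 hp1 hr hr0 hq hqbar hX).
  rewrite (passage_value_moment hlambda hmu hp hp0 hp1 hr hr0 hq hqbar hqb hN hax).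
  by rewrite /Phi -mulf_div divff ?mul1r// gt_eqF// subr_gt0.
- move=> r1 mu0 qbar0; have b1 := qb qbar0.
  have hN : mu * (rtilde r (varphi lambda p qbar) - 1) < 0.
    have hb : 0 <= varphi lambda p qbar <= 1 by lra.
    by rewrite pmulr_rlt0//; have := rtilde_up_le hr r1 hr0 hb; lra.
  rewrite (passage_transform_kernel _ _ hlambda hmu hp hp0 hp1 hr hr0
    (lexx 0) hqbar hX).
  rewrite (passage_value_moment hlambda hmu hp hp0 hp1 hr hr0 (lexx 0) hqbar
    (or_intror b1) hN hax).
  have -> : phi mu r 0 = 0 by rewrite /phi r1 mulr0 ltxx.
  by under eq_fun do rewrite add0r.
- move=> mu0; move: hX; rewrite mu0 => hX0.
  rewrite (passage_transform_kernel _ _ hlambda (lexx 0) hp hp0 hp1 hr hr0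
    (lexx 0) hqbar hX0).
  exact: passage_value_power.
Qed.
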